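(* Let $\Theta\subset\mathbb{R}^d$ be compact and let $\{f_\theta:\theta\in\Theta\}$ be a family of non-decreasing functions $f_\theta:\mathbb{N}_+\to(0,\infty)$ such that $\theta\mapsto f_\theta(k)$ is twice continuously differentiable for every $k$. Suppose there is a constant $C>0$ such that, for every $\theta\in\Theta$, either $f_\theta(k)\le Ck^{\beta}$ for every $k\in\mathbb{N}_+$, for some $\beta<1$, or $f_\theta(k)=k+\alpha$ for every $k\in\mathbb{N}_+$, for some $\alpha>-1$. Let the true parameter $\theta_0\in\Theta$ be identifiable, in the sense that for $\theta\in\Theta$ one has $f_\theta(k)=c f_{\theta_0}(k)$ for every $k\in\mathbb{N}_+$ and some constant $c$ if and only if $\theta=\theta_0$. Let $\hat\theta_n$ be the maximum likelihood estimator, i.e. a maximizer over $\theta\in\Theta$ of $$\iota_n(f_\theta)=\sum_{k=1}^\infty \log f_\theta(k)\,P_{>k}(n)-\frac1n\sum_{t=2}^n\log S_{f_\theta}(t-1),$$ computed from the preferential attachment tree generated with preferential attachment function $f_{\theta_0}$. Then $\hat\theta_n\to\theta_0$ almost surely as $n\to\infty$.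
   Context: Preferential attachment (PA) tree with PA function $f:\mathbb{N}_+\to(0,\infty)$: at time $1$ there is a single node $v_1$, of degree $1$ (a root with a loose edge). Given the tree at time $n$ with nodes $v_1,\dots,v_n$ of degrees $d_1(n),\dots,d_n(n)$, a new node $v_{n+1}$ of degree $1$ is attached by an edge to the node $v_i$ with conditional probability $f(d_i(n))/\sum_{j=1}^n f(d_j(n))$ given the past; the degree of the chosen node increases by $1$. $N_k(n)$ is the number of nodes of degree $k$ at time $n$, $P_k(n)=N_k(n)/n$, $P_{>k}(n)=\sum_{l>k}P_l(n)$, and for a function $h$ on $\mathbb{N}_+$, $S_h(n)=\sum_{k=1}^\infty h(k)N_k(n)$. The function $\iota_n(f_\theta)$ is, up to an additive term not depending on $\theta$, the log-likelihood of the evolution of the tree up to time $n$ divided by $n$. *)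

(* Defs.v *)
From HB Require Import structures.
From mathcomp Require Import all_boot all_order all_algebra.
From mathcomp Require Import all_classical all_reals all_analysis.

Set Implicit Arguments.
Unset Strict Implicit.
Unset Printing Implicit Defensive.

Import Order.TTheory GRing.Theory Num.Theory.
Import numFieldNormedType.Exports.

Local Open Scope classical_set_scope.
Local Open Scope ring_scope.

Local Notation "\sum_ ( m <= i '<oo' ) F" :=
  (\big[+%R/0%R]_(m <= i <oo) F%R) : ring_scope.

(* A realization of the tree evolution is a sequence a : nat -> nat of parent
   indices: for t >= 1, the node v_{t+1} is attached to v_(a t).  Nodes and
   times are numbered from 1; the value a 0 is never used. *)

(* d_i(n), for 1 <= i <= n: the node v_i has one edge to its parent (the loose
   edge if i = 1) and one edge to each node attached to it before time n. *)
Definition degree (a : nat -> nat) (n i : nat) : nat :=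
  (1 + \sum_(1 <= t < n) (a t == i))%N.

(* N_k(n) *)
Definition num_degree (a : nat -> nat) (k n : nat) : nat :=
  (\sum_(1 <= i < n.+1) (degree a n i == k))%N.

Section statistics.
Variable R : realType.

(* P_k(n) *)
Definition prop_degree (a : nat -> nat) (k n : nat) : R :=
  (num_degree a k n)%:R / n%:R.

(* P_{>k}(n); the series has finitely many nonzero terms *)
Definition prop_degree_gt (a : nat -> nat) (k n : nat) : R :=
  \sum_(k.+1 <= l <oo) prop_degree a l n.

(* S_h(n) *)
Definition total_weight (h : nat -> R) (a : nat -> nat) (n : nat) : R :=
  \sum_(1 <= k <oo) (h k * (num_degree a k n)%:R).

(* iota_n(h) *)
Definition loglik (h : nat -> R) (a : nat -> nat) (n : nat) : R :=
  (\sum_(1 <= k <oo) (ln (h k) * prop_degree_gt a k n))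
  - n%:R^-1 * (\sum_(2 <= t < n.+1) ln (total_weight h a t.-1)).

(* Partial derivatives up to order 2 exist and are continuous at the points
   of U (meant for U open). *)
Definition C2_on (d : nat) (U : set 'rV[R]_d) (g : 'rV[R]_d -> R) : Prop :=
  forall x : 'rV[R]_d, U x ->
  [/\ {for x, continuous g},
      forall i : 'I_d,
        derivable g x (delta_mx 0 i) /\
        {for x, continuous ('D_(delta_mx 0 i) g)}
    & forall i j : 'I_d,
        derivable ('D_(delta_mx 0 i) g) x (delta_mx 0 j) /\
        {for x, continuous ('D_(delta_mx 0 j) ('D_(delta_mx 0 i) g))}].

(* On a set that need not be open, C^2 means: restriction of a function that
   is C^2 on an open neighbourhood of the set. *)
Definition C2_within (d : nat) (D : set 'rV[R]_d) (g : 'rV[R]_d -> R) : Prop :=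
  exists (U : set 'rV[R]_d) (g' : 'rV[R]_d -> R),
    [/\ open U, D `<=` U, C2_on U g' & {in D, g =1 g'}].

End statistics.

Section process.
Context (dT : measure_display) (T : measurableType dT) (R : realType).
Variable P : probability T R.

(* elementary conditional probability of E given B, for P B != 0 *)
Definition cond_prob (E B : set T) : R := fine (P (E `&` B)) / fine (P B).

(* The event that the evolution up to time n is the one described by a; these
   events are the atoms of the past at time n. *)
Definition past (A : nat -> T -> nat) (n : nat) (a : nat -> nat) : set T :=
  [set w | forall t, (0 < t < n)%N -> A t w = a t].

(* A is the random sequence of parent indices of a preferential attachment
   tree with preferential attachment function f. *)
Definition is_pa_tree (f : nat -> R) (A : nat -> {RV P >-> nat}) : Prop :=
  (forall n w, (0 < n)%N -> (0 < A n w <= n)%N) /\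
  (forall (n i : nat) (a : nat -> nat), (0 < n)%N -> (0 < i <= n)%N ->
     P (past A n a) != 0%E ->
     cond_prob [set w | A n w = i] (past A n a) =
       f (degree a n i) / \sum_(1 <= j < n.+1) f (degree a n j)).

End process.

(* Main.v *)
(* Let D_t be the degree of the node chosen at time t and S_h(t) the sum of h
   over the degrees at time t.  Up to the factor n, the log-likelihood is the
   sum over t < n of log (h(D_t) / S_h(t)), so the comparison of theta with
   theta0 is a sum of logarithms of one-step likelihood ratios.  The convergence
   of the degree proportions is not needed: three facts about the tree suffice,
   each deduced from exponential Markov inequalities and Borel-Cantelli.

   (a) Every degree k has a probability of being chosen which, on average over
   time, stays away from 0; for k = 1 it even does so at every large time.
   (b) The nodes of degree above K carry a proportion of the total degree that is
   small, uniformly in time, when K is large.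
   (c) If w(t, .) > 0 depends on the past only and has conditional mean at most 1
   at D_t, then the sum over t < n of log w(t, D_t) is at most eps n eventually.

   Given theta1 <> theta0, let W bound the one-step likelihood ratios of all theta
   close to theta1; by (b) its conditional mean is close to 1.  Since
   2 sqrt W = W + 1 - (sqrt W - 1)^2, and since by identifiability W cannot be
   close to 1 both at degree 1 and at some other degree k0, (a) shows that the
   conditional mean of sqrt W is below 1 by a fixed amount on average.  Applying
   (c) to sqrt W divided by (a bound on) its conditional mean, the log-likelihood
   is eventually smaller on a neighbourhood of theta1 than at theta0, and
   compactness of Theta concludes. *)
Require Import Defs.
From HB Require Import structures.
From mathcomp Require Import all_boot all_order all_algebra.
From mathcomp Require Import all_classical all_reals all_analysis.
From mathcomp Require Import ring lra zify.

Set Implicit Arguments.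
Unset Strict Implicit.
Unset Printing Implicit Defensive.

Import Order.TTheory GRing.Theory Num.Theory.
Import numFieldNormedType.Exports.

Local Open Scope classical_set_scope.
Local Open Scope ring_scope.

(** * Degrees along a deterministic history *)

Definition valid_history (a : nat -> nat) : Prop :=
  forall n, (0 < n)%N -> (0 < a n <= n)%N.

Definition chosen_degree (a : nat -> nat) (t : nat) : nat := degree a t (a t).

Definition deg_sum (R : realType) (h : nat -> R) (a : nat -> nat) (n : nat) : R :=
  \sum_(1 <= i < n.+1) h (degree a n i).

Lemma eq_degree a b n i : (forall t, (0 < t < n)%N -> a t = b t) ->
  degree a n i = degree b n i.
Proof. by move=> eab; congr addn; apply: eq_big_nat => t ht; rewrite eab. Qed.

Lemma degreeS a n i : (0 < n)%N -> degree a n.+1 i = (degree a n i + (a n == i))%N.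
Proof. by move=> n0; rewrite /degree big_nat_recr//= addnA. Qed.

Lemma degree_gt0 a n i : (0 < degree a n i)%N.
Proof. by rewrite /degree add1n. Qed.

Lemma degree_le a n i : (0 < n)%N -> (degree a n i <= n)%N.
Proof.
elim: n => // -[_ _|n IH _]; first by rewrite /degree big_geq.
by rewrite degreeS// -[n.+2]addn1 leq_add// ?IH// leq_b1.
Qed.

(** Serves both the newest node [v_n], which no earlier choice can have hit, and the indices beyond
    the tree, where [degree] takes the default value 1. *)
Lemma degree_new a n i : valid_history a -> (n <= i)%N -> degree a n i = 1%N.
Proof.
move=> va ni; rewrite /degree big_nat big1// => t /andP[t0 tn].
have /andP[_ at_le] := va t t0.
by apply/eqP; rewrite eqb0 neq_ltn (leq_ltn_trans at_le)// (leq_trans tn).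
Qed.

(** * Sums of a function over the current degrees *)

Section deg_sum.
Context (R : realType).
Implicit Types (h : nat -> R) (a : nat -> nat).

Lemma eq_deg_sum h1 h2 a n : (forall k, (0 < k)%N -> h1 k = h2 k) ->
  deg_sum h1 a n = deg_sum h2 a n.
Proof. by move=> e; apply: eq_bigr => i _; rewrite e ?degree_gt0. Qed.

Lemma eq_deg_sum_history h a b n : (forall t, (0 < t < n)%N -> a t = b t) ->
  deg_sum h a n = deg_sum h b n.
Proof. by move=> e; apply: eq_bigr => i _; rewrite (eq_degree _ e). Qed.

Lemma ler_deg_sum h1 h2 a n : (forall k, (0 < k)%N -> h1 k <= h2 k) ->
  deg_sum h1 a n <= deg_sum h2 a n.
Proof. by move=> le; apply: ler_sum => i _; rewrite le ?degree_gt0. Qed.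

Lemma deg_sumD h1 h2 a n :
  deg_sum (fun k => h1 k + h2 k) a n = deg_sum h1 a n + deg_sum h2 a n.
Proof. exact: big_split. Qed.

Lemma deg_sumZ c h a n : deg_sum (fun k => c * h k) a n = c * deg_sum h a n.
Proof. by rewrite /deg_sum mulr_sumr. Qed.

Lemma deg_sum_cst (c : R) a n : deg_sum (fun=> c) a n = n%:R * c.
Proof. by rewrite /deg_sum sumr_const_nat subn1 mulr_natl. Qed.

Lemma deg_sum_ge0 h a n : (forall k, (0 < k)%N -> 0 <= h k) -> 0 <= deg_sum h a n.
Proof. by move=> h0; apply: sumr_ge0 => i _; rewrite h0 ?degree_gt0. Qed.

Lemma deg_sumS h a n : valid_history a -> (0 < n)%N ->
  deg_sum h a n.+1 = deg_sum h a n + h 1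
    + (h (chosen_degree a n).+1 - h (chosen_degree a n)).
Proof.
move=> va n0; rewrite {1}/deg_sum big_nat_recr//= degree_new// addrAC; congr (_ + _).
apply/eqP; rewrite -subr_eq0 opprD addrA -/(deg_sum _ _ _) subr_eq0; apply/eqP.
rewrite /deg_sum -sumrB.
have /andP[an0 an] := va n n0.
rewrite (bigD1_seq (a n))/= ?iota_uniq//; last by rewrite mem_index_iota an0.
rewrite big1 ?addr0 => [|i /negPf ani]; last first.
  by rewrite degreeS// eq_sym ani addn0 subrr.
by rewrite degreeS// eqxx addn1.
Qed.

(* Only the degree of the chosen node changes, so every statistic of the form
   deg_sum is a sum over the successive choices. *)
Lemma deg_sumE h a n : valid_history a ->
  deg_sum h a n = n%:R * h 1
    + \sum_(1 <= t < n) (h (chosen_degree a t).+1 - h (chosen_degree a t)).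
Proof.
move=> va; elim: n => [|[|n] IH].
- by rewrite mul0r add0r /deg_sum !big_geq.
- by rewrite mul1r big_geq// addr0 /deg_sum big_nat1 degree_new.
- rewrite deg_sumS// IH [in RHS]big_nat_recr//= -[in RHS]natr1.
  by ring.
Qed.

(** Turns a sum over the successive choices into a statistic of the current degrees: [h] is the
    discrete primitive of [g] vanishing at degree 1. *)
Lemma deg_sum_telescope h g a n : valid_history a -> h 1 = 0 ->
  (forall k, (0 < k)%N -> h k.+1 = h k + g k) ->
  deg_sum h a n = \sum_(1 <= t < n) g (chosen_degree a t).
Proof.
move=> va h1 hS; rewrite deg_sumE// h1 mulr0 add0r.
by apply: eq_bigr => t _; rewrite hS ?degree_gt0// addrC addKr.
Qed.

Lemma deg_sum_id a n : valid_history a -> deg_sum (fun k => k%:R : R) a n <= 2 * n%:R.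
Proof.
move=> va; rewrite deg_sumE// mulr1 mulr_natl mulr2n lerD2l.
rewrite (eq_bigr (fun=> 1)) => [|t _]; last by rewrite -natr1 addrC addKr.
by rewrite sumr_const_nat ler_nat leq_subr.
Qed.

Lemma deg_sum_ge h a n : (0 < n)%N -> (forall j k, (0 < j)%N -> (j <= k)%N -> h j <= h k) ->
  n%:R * h 1 <= deg_sum h a n.
Proof. by move=> n0 hh; rewrite -(deg_sum_cst _ a); apply: ler_deg_sum => k k0; apply: hh. Qed.

Lemma deg_sum_gt0 h a n : (0 < n)%N -> (forall k, (0 < k)%N -> 0 < h k) ->
  0 < deg_sum h a n.
Proof.
move=> n0 h0; rewrite /deg_sum big_nat_recl//=.
rewrite ltr_pwDl ?h0 ?degree_gt0// sumr_ge0// => i _.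
by rewrite ltW// h0 ?degree_gt0.
Qed.

End deg_sum.

(** * The log-likelihood as a sum over the choices *)

Section loglik.
Context (R : realType).
Implicit Types (h : nat -> R) (a : nat -> nat).

Lemma series_finite (u : nat -> R) m N : (forall k, (N <= k)%N -> u k = 0) ->
  \big[+%R/0%R]_(m <= k <oo) u k = \sum_(m <= k < N) u k.
Proof.
move=> u0; apply: lim_near_cst => //.
exists N => // n /= Nn; have [mN|Nm] := leqP m N.
  rewrite (big_cat_nat _ Nn)//= [X in _ + X]big_nat [X in _ + X]big1 ?addr0//.
  by move=> i /andP[Ni _]; exact: u0.
rewrite [in RHS]big_geq ?(ltnW Nm)// big_nat big1// => i /andP[mi _].
by rewrite u0// (leq_trans (ltnW Nm)).
Qed.

Lemma num_degreeE a k n :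
  (num_degree a k n)%:R = deg_sum (fun d => (d == k)%:R) a n :> R.
Proof. by rewrite /num_degree /deg_sum natr_sum. Qed.

Lemma num_degree_eq0 a k n : (n < k)%N -> num_degree a k n = 0%N.
Proof.
move=> nk; rewrite /num_degree big_nat big1// => i /andP[i0 iN].
apply/eqP; rewrite eqb0 neq_ltn (leq_ltn_trans _ nk)//.
by apply: degree_le; exact: leq_trans i0 iN.
Qed.

Lemma total_weightE h a n : total_weight h a n = deg_sum h a n.
Proof.
rewrite /total_weight (@series_finite _ _ n.+1) => [|k nk]; last first.
  by rewrite num_degree_eq0// mulr0.
under eq_bigr do rewrite num_degreeE /deg_sum mulr_sumr.
rewrite exchange_big/= /deg_sum; apply: eq_big_nat => i /andP[i0 iN].
rewrite (bigD1_seq (degree a n i))/= ?iota_uniq//; last first.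
  by rewrite mem_index_iota degree_gt0/= ltnS degree_le// (leq_trans i0).
rewrite eqxx mulr1 big1 ?addr0// => k /negPf; rewrite eq_sym => ->.
by rewrite mulr0.
Qed.

Lemma prop_degree_gtE a k n :
  prop_degree_gt R a k n = deg_sum (fun d => (k < d)%:R) a n / n%:R.
Proof.
rewrite /prop_degree_gt (@series_finite _ _ n.+1) => [|l nl]; last first.
  by rewrite /prop_degree num_degree_eq0// mul0r.
rewrite /prop_degree -mulr_suml; congr (_ / _).
under eq_bigr do rewrite num_degreeE /deg_sum.
rewrite exchange_big/= /deg_sum; apply: eq_big_nat => i /andP[i0 iN].
have dn : (degree a n i <= n)%N by rewrite degree_le// (leq_trans i0).
have [kd|dk] := ltnP k (degree a n i); last first.
  rewrite big_nat big1// => l /andP[kl _]; rewrite [_ == _]ltn_eqF//.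
  exact: leq_ltn_trans dk kl.
rewrite (bigD1_seq (degree a n i))/= ?iota_uniq//; last first.
  by rewrite mem_index_iota kd/= ltnS.
by rewrite eqxx big1 ?addr0// => l /negPf; rewrite eq_sym => ->.
Qed.

(** Every node is born with degree 1, so a node of degree above [k] was chosen exactly once while it
    had degree [k]. Hence [n] times the proportion of such nodes counts the choices made at degree
    [k]. *)
Lemma loglikE h a n : valid_history a -> (0 < n)%N ->
  loglik h a n = n%:R^-1 *
    \sum_(1 <= t < n) (ln (h (chosen_degree a t)) - ln (deg_sum h a t)).
Proof.
move=> va n0; rewrite /loglik sumrB mulrBr; congr (_ - _); last first.
  by rewrite big_add1/=; congr (_ * _); apply: eq_bigr => t _; rewrite total_weightE.
rewrite (@series_finite _ _ n.+1) => [|k nk]; last first.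
  rewrite prop_degree_gtE /deg_sum big_nat big1 ?mul0r ?mulr0// => i /andP[i0 iN].
  by rewrite ltnNge (leq_trans _ (ltnW nk))// degree_le// (leq_trans i0).
under eq_bigr do rewrite prop_degree_gtE mulrA.
rewrite -mulr_suml mulrC; congr (_ * _).
pose g k := \sum_(1 <= l < k) ln (h l).
rewrite -(@deg_sum_telescope _ g (fun k => ln (h k)))//; last 2 first.
- by rewrite /g big_geq.
- by move=> k k0; rewrite /g big_nat_recr.
under eq_bigr do rewrite /deg_sum mulr_sumr.
rewrite exchange_big/= /deg_sum; apply: eq_big_nat => i /andP[i0 iN].
have dn : (degree a n i <= n)%N by rewrite degree_le// (leq_trans i0).
rewrite (big_cat_nat (degree_gt0 a n i) (leqW dn))/= [X in _ + X]big_nat.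
rewrite [X in _ + X]big1 ?addr0 => [|k /andP[dk _]]; last by rewrite ltnNge dk mulr0.
by apply: eq_big_nat => k /andP[_ kd]; rewrite kd mulr1.
Qed.

End loglik.

(** * Exponential Markov inequality for predictable weights *)

Section exponential_bound.
Context {d : measure_display} {T : measurableType d} {R : realType}.
Context (P : probability T R) (f : nat -> R) (A : nat -> {RV P >-> nat}).
Hypothesis f_gt0 : forall k, (0 < k)%N -> 0 < f k.
Hypothesis A_pa : is_pa_tree f A.

Lemma pa_valid w : valid_history (fun t => A t w).
Proof. by move=> n n0; have [+ _] := A_pa; apply. Qed.

(** Refines an atom of the past by one choice: [past A m] fixes the choices before [m], so the new
    one sits at index [m]. *)
Definition extend_history (a : nat -> nat) m i : nat -> nat :=
  fun t => if t == m then i else a t.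

Lemma past_extend a m i : (0 < m)%N ->
  past A m.+1 (extend_history a m i) = [set w | A m w = i] `&` past A m a.
Proof.
move=> m0; apply/seteqP; split=> w /=.
- move=> H; split.
    by have := H m; rewrite /extend_history eqxx; apply; rewrite m0/=.
  move=> t /andP[t0 tm]; have := H t; rewrite /extend_history (ltn_eqF tm).
  by apply; rewrite t0 ltnS ltnW.
- move=> [Ami pa] t /andP[t0 tm]; rewrite /extend_history; case: eqVneq => [->//|tNm].
  by apply: pa; rewrite t0/= ltn_neqAle tNm -ltnS.
Qed.

Lemma measurable_past a m : measurable (past A m a).
Proof.
elim: m a => [|[|m] IH] a.
- rewrite [past _ _ _](_ : _ = setT)//; apply/seteqP; split=> // w _ t /=.
  by rewrite ltn0 andbF.
- rewrite [past _ _ _](_ : _ = setT)//; apply/seteqP; split=> // w _ t /=.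
  by case: t.
- have Ea : extend_history a m.+1 (a m.+1) = a.
    by apply/funext => t; rewrite /extend_history; case: eqVneq => [->|//].
  rewrite -Ea past_extend//; apply: measurableI => //.
  by rewrite -[X in measurable X]/(A m.+1 @^-1` [set a m.+1]); exact: measurable_funPTI.
Qed.

(** The chain rule, in product form so that it also covers null atoms, where [is_pa_tree] prescribes
    no conditional probability and both sides vanish. *)
Lemma past_extend_prob a m i : (0 < m)%N -> (0 < i <= m)%N ->
  fine (P (past A m.+1 (extend_history a m i))) =
  fine (P (past A m a)) * (f (degree a m i) / deg_sum f a m).
Proof.
move=> m0 im; rewrite past_extend//.
have [P0|P0] := eqVneq (P (past A m a)) 0%E.
  rewrite P0 mul0r; suff -> : P ([set w | A m w = i] `&` past A m a) = 0%E by [].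
  apply/eqP; rewrite eq_le measure_ge0 andbT -P0 -past_extend//.
  rewrite le_measure ?inE; [by []|exact: measurable_past|exact: measurable_past|].
  by rewrite past_extend//; exact: subIsetr.
have [_ /(_ m i a m0 im P0)] := A_pa; rewrite /cond_prob => E.
rewrite -[f _ / _]E mulrC divfK// fine_eq0//.
by rewrite fin_num_measure//; exact: measurable_past.
Qed.

Definition choice_weight (om : nat -> (nat -> nat) -> nat -> R) m n a : R :=
  \prod_(m <= t < n) om t a (chosen_degree a t).

Context (om : nat -> (nat -> nat) -> nat -> R).
Hypothesis om_gt0 : forall t a k, (0 < t)%N -> valid_history a -> (0 < k)%N ->
  0 < om t a k.
Hypothesis om_predictable : forall t a b k,
  (forall s, (0 < s < t)%N -> a s = b s) -> om t a k = om t b k.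
Hypothesis om_le : forall t a, (0 < t)%N -> valid_history a ->
  deg_sum (fun k => f k * om t a k) a t <= deg_sum f a t.

(* Conditionally on the past at time m, the products of the weights form a
   nonnegative supermartingale; this is Markov's inequality for it. *)
Lemma past_markov n m a (c : R) : (0 < m <= n)%N -> valid_history a -> 0 < c ->
  let E := past A m a `&` [set w | c <= choice_weight om m n (fun t => A t w)] in
  measurable E /\ (P E <= (fine (P (past A m a)) / c)%:E)%E.
Proof.
(* Backward induction in [m], starting from [m = n], where the product is empty and the event is the
   whole atom or nothing. *)
move: {2}(n - m)%N (erefl (n - m)%N) => j.
elim: j m a c => [|j IH] m a c nm /andP[m0 mn] va c0 /=.
  have {nm mn} -> : n = m by apply/eqP; rewrite eqn_leq mn -subn_eq0 nm.
  rewrite /choice_weight; have [c1|c1] := leP c 1.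
    rewrite [X in _ `&` X](_ : _ = setT) ?setIT; last first.
      by apply/seteqP; split=> // w _ /=; rewrite big_geq.
    have mp := measurable_past a m; split=> //.
    rewrite -[leLHS]fineK ?fin_num_measure// lee_fin ler_peMr ?fine_ge0//.
    by rewrite invr_ge1 ?unitf_gt0.
  rewrite [X in _ `&` X](_ : _ = set0) ?setI0; last first.
    by apply/seteqP; split=> // w /=; rewrite big_geq// leNgt c1.
  split; first exact: measurable0.
  by rewrite measure0 lee_fin divr_ge0 ?fine_ge0 ?(ltW c0).
have {}mn : (m < n)%N by rewrite -subn_gt0 nm.
set E := _ `&` _.
(* Split the atom according to the parent [v_(i+1)] chosen at time [m], and move the first factor of
   the product into the threshold. *)
pose F i := past A m.+1 (extend_history a m i.+1) `&`
  [set w | c / om m a (degree a m i.+1) <= choice_weight om m.+1 n (fun t => A t w)].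
have F_ind i : (i < m)%N -> measurable (F i) /\
    (P (F i) <= (fine (P (past A m.+1 (extend_history a m i.+1))) /
                  (c / om m a (degree a m i.+1)))%:E)%E.
  move=> im; apply: IH.
  - by rewrite subnS nm.
  - by [].
  - move=> t t0; rewrite /extend_history; case: eqVneq => [->//|_]; exact: va.
  - by rewrite divr_gt0 ?om_gt0.
have EF : E = \big[setU/set0]_(i < m) F i.
  rewrite /E -bigcup_mkord; apply/seteqP; split=> w /=.
    move=> [pa Zc]; have /andP[Am0 Am] := pa_valid w m0.
    have Em : (A m w).-1.+1 = A m w by rewrite prednK.
    exists (A m w).-1; first by rewrite /= Em.
    rewrite /F past_extend// Em; split; first by split.
    move: Zc; rewrite /= /choice_weight big_ltn//= ler_pdivrMr ?om_gt0// mulrC.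
    congr (_ <= _ * _); rewrite (om_predictable (b := a))//.
    congr om; rewrite /chosen_degree.
    exact: eq_degree.
  move=> [i /= im]; rewrite /F past_extend// => -[[/= Ami pa] Zc]; split=> //.
  move: Zc; rewrite /= /choice_weight [in X in _ -> X]big_ltn//= ler_pdivrMr ?om_gt0// mulrC.
  congr (_ <= _ * _); rewrite [RHS](om_predictable (b := a))//.
  congr om; rewrite /chosen_degree Ami; apply/esym.
  exact: eq_degree.
have mE : measurable E.
  by rewrite EF; apply: bigsetU_measurable => i _; exact: (F_ind i _).1.
split=> //; rewrite EF.
apply: (le_trans (Boole_inequality _ _)) => [i im|]; first exact: (F_ind i im).1.
apply: (@le_trans _ _ (\sum_(i < m) (fine (P (past A m a)) * (f (degree a m i.+1) *
    om m a (degree a m i.+1)) / deg_sum f a m / c)%:E)%E).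
  apply: lee_sum => i _; apply: (le_trans (F_ind i (ltn_ord i)).2).
  rewrite lee_fin past_extend_prob// ?ltn_ord// invf_div le_eqVlt; apply/orP; left.
  by apply/eqP; ring.
(* By [om_le] at time [m], the conditional mean of the first factor is at most 1. *)
rewrite sumEFin lee_fin -!mulr_suml ler_wpM2r ?invr_ge0 ?(ltW c0)//.
rewrite -mulr_sumr -mulrA.
rewrite ler_piMr ?fine_ge0//.
rewrite ler_pdivrMr ?deg_sum_gt0// mul1r.
rewrite -(big_mkord xpredT (fun i => f (degree a m i.+1) * om m a (degree a m i.+1))).
by have := om_le m0 va; rewrite {1}/deg_sum big_add1.
Qed.

End exponential_bound.

(** * Borel-Cantelli with geometric bounds *)

Section borel_cantelli.
Context {d : measure_display} {T : measurableType d} {R : realType}.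
Context (P : probability T R).

Lemma ae_near_not (E : nat -> set T) (e : R) : 0 < e ->
  (forall n, measurable (E n)) -> (forall n, P (E n) <= (expR (- e * n%:R))%:E)%E ->
  {ae P, forall w, \forall n \near \oo, ~ E n w}.
Proof.
move=> e0 mE PE; exists (lim_sup_set E); split.
- by apply: bigcap_measurable => // n _; apply: bigcup_measurable.
- apply: lim_sup_set_cvg0 => //.
  set q := expR (- e).
  have q0 : 0 <= q by exact: expR_ge0.
  have q1 : q < 1 by rewrite /q -expR0 ltr_expR oppr_lt0.
  apply: (@le_lt_trans _ _ ((1 - q)^-1)%:E); last exact: ltry.
  apply: lime_le; first by apply: is_cvg_nneseries => *; exact: measure_ge0.
  apply: nearW => n /=.
  apply: (@le_trans _ _ (\sum_(0 <= i < n) (q ^+ i)%:E)%E).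
    apply: lee_sum => i _; rewrite (le_trans (PE i))// lee_fin.
    by rewrite expRM_natr.
  rewrite sumEFin lee_fin big_mkord -[leRHS]mul1r ler_pdivlMr ?subr_gt0//.
  rewrite mulrC -opprB mulNr -subrX1 opprB lerBlDr lerDl exprn_ge0//.
- move=> w /= nE n _ /=; apply: contrapT => H; apply: nE.
  exists n => // k /= nk Ek; apply: H; exists k => //=.
Qed.

End borel_cantelli.

(** * Conditional means of functions of the chosen degree *)

(* The conditional mean, given the tree at time t, of h at the degree of the
   next chosen node. *)
Definition cond_mean (R : realType) (f h : nat -> R) (a : nat -> nat) (t : nat) : R :=
  deg_sum (fun k => f k * h k) a t / deg_sum f a t.

Section cond_mean.
Context (R : realType) (f : nat -> R).
Hypothesis f_gt0 : forall k, (0 < k)%N -> 0 < f k.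
Implicit Types (h : nat -> R) (a : nat -> nat) (t : nat).

Lemma cond_meanE h a t : (0 < t)%N ->
  deg_sum (fun k => f k * h k) a t = cond_mean f h a t * deg_sum f a t.
Proof. by move=> t0; rewrite /cond_mean divfK// gt_eqF// deg_sum_gt0. Qed.

Lemma ler_cond_mean h1 h2 a t : (forall k, (0 < k)%N -> h1 k <= h2 k) ->
  cond_mean f h1 a t <= cond_mean f h2 a t.
Proof.
move=> le; rewrite ler_wpM2r ?invr_ge0 ?deg_sum_ge0// => [k k0|].
  by rewrite ltW// f_gt0.
by apply: ler_deg_sum => k k0; rewrite ler_wpM2l ?le// ltW// f_gt0.
Qed.

Lemma cond_meanD h1 h2 a t :
  cond_mean f (fun k => h1 k + h2 k) a t = cond_mean f h1 a t + cond_mean f h2 a t.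
Proof.
rewrite /cond_mean -mulrDl -deg_sumD; congr (_ / _).
by apply: eq_bigr => i _; rewrite mulrDr.
Qed.

Lemma cond_meanZ c h a t : cond_mean f (fun k => c * h k) a t = c * cond_mean f h a t.
Proof.
rewrite /cond_mean mulrA -deg_sumZ; congr (_ / _).
by apply: eq_bigr => i _; rewrite mulrCA.
Qed.

Lemma cond_mean_cst c a t : (0 < t)%N -> cond_mean f (fun=> c) a t = c.
Proof.
move=> t0; rewrite /cond_mean -[RHS]mulr1 -(@divff _ (deg_sum f a t)).
  rewrite mulrA -deg_sumZ; congr (_ / _).
  by apply: eq_bigr => i _; rewrite mulrC.
by rewrite gt_eqF// deg_sum_gt0.
Qed.

Lemma cond_mean_ge0 h a t : (forall k, (0 < k)%N -> 0 <= h k) -> 0 <= cond_mean f h a t.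
Proof.
move=> h0; rewrite divr_ge0// deg_sum_ge0// => k k0.
  by rewrite mulr_ge0 ?h0// ltW// f_gt0.
by rewrite ltW// f_gt0.
Qed.

Lemma cond_mean_le1 h a t : (0 < t)%N -> (forall k, (0 < k)%N -> h k <= 1) ->
  cond_mean f h a t <= 1.
Proof. by move=> t0 h1; rewrite -(cond_mean_cst 1 a t0); exact: ler_cond_mean. Qed.

Lemma eq_cond_mean_history h a b t : (forall s, (0 < s < t)%N -> a s = b s) ->
  cond_mean f h a t = cond_mean f h b t.
Proof. by move=> ab; congr (_ / _); exact: eq_deg_sum_history. Qed.

End cond_mean.

(** From [expR (- x) >= 1 - x] one gets [expR x <= (1 - x)^-1], and
    [(1 + x + 2 * x ^+ 2) * (1 - x) >= 1] for [x <= 1 / 2]. *)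
Lemma expR_le_quadratic (R : realType) (x : R) : x <= 1 / 2 ->
  expR x <= 1 + x + 2 * x ^+ 2.
Proof.
move=> x2; have x1 : 0 < 1 - x by lra.
have le1 : expR x <= (1 - x)^-1.
  rewrite -[expR x]invrK lef_pV2 ?posrE ?invr_gt0 ?expR_gt0// -expRN.
  exact: expR_ge1Dx.
apply: (le_trans le1); rewrite -[leLHS]mul1r ler_pdivrMr//.
have -> : (1 + x + 2 * x ^+ 2) * (1 - x) = 1 + x ^+ 2 * (1 - 2 * x) by ring.
by rewrite lerDl mulr_ge0 ?sqr_ge0//; lra.
Qed.

(** * Almost sure bounds for sums over the choices *)

Section strong_law.
Context {d : measure_display} {T : measurableType d} {R : realType}.
Context (P : probability T R) (f : nat -> R) (A : nat -> {RV P >-> nat}).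
Hypothesis f_gt0 : forall k, (0 < k)%N -> 0 < f k.
Hypothesis A_pa : is_pa_tree f A.

(** Fact (c): [past_markov] from time 1, where the past is trivial, with threshold
    [expR (e * n%:R)], then Borel-Cantelli. *)
Lemma ae_sum_ln_weight (om : nat -> (nat -> nat) -> nat -> R) (e : R) : 0 < e ->
  (forall t a k, (0 < t)%N -> valid_history a -> (0 < k)%N -> 0 < om t a k) ->
  (forall t a b k, (forall s, (0 < s < t)%N -> a s = b s) -> om t a k = om t b k) ->
  (forall t a, (0 < t)%N -> valid_history a ->
    deg_sum (fun k => f k * om t a k) a t <= deg_sum f a t) ->
  {ae P, forall w, let a := fun t => A t w in
    \forall n \near \oo,
    \sum_(1 <= t < n) ln (om t a (chosen_degree a t)) <= e * n%:R}.
Proof.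
move=> e0 om_gt0 om_pred om_le.
pose E n := [set w | expR (e * n%:R) <= choice_weight om 1 n (fun t => A t w)].
have v1 : valid_history (fun=> 1%N) by move=> n n0.
have past1 : past A 1 (fun=> 1%N) = setT.
  by apply/seteqP; split=> // w _ [].
have EP n : measurable (E n) /\ (P (E n) <= (expR (- e * n%:R))%:E)%E.
  (* [past_markov] needs [m <= n]; at [n = 0] the probability bound is 1. *)
  case: n => [|n].
    rewrite (_ : E 0 = setT); last first.
      by apply/seteqP; split=> // w _; rewrite /E /choice_weight /= big_geq// mulr0 expR0.
    by rewrite probability_setT mulr0 expR0.
  have := past_markov f_gt0 A_pa om_gt0 om_pred om_le (n := n.+1) (m := 1) isT v1
    (expR_gt0 (e * n.+1%:R)).
  by rewrite past1 setTI probability_setT mul1r -expRN mulNr.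
apply: filterS (ae_near_not e0 (fun n => (EP n).1) (fun n => (EP n).2)) => w /=.
set a := fun t => A t w; have va : valid_history a by exact: pa_valid A_pa w.
apply: filterS => n /negP; rewrite -ltNge => H.
have om0 t : (1 <= t)%N -> 0 < om t a (chosen_degree a t).
  by move=> t0; rewrite om_gt0// degree_gt0.
have -> : \sum_(1 <= t < n) ln (om t a (chosen_degree a t)) = ln (choice_weight om 1 n a).
  rewrite /choice_weight; elim: n {H} => [|[|n] IH]; [by rewrite !big_geq// ln1..|].
  rewrite big_nat_recr//= IH [in RHS]big_nat_recr//= lnM ?posrE ?om0//.
  by rewrite big_nat prodr_gt0// => t /andP[t0 _]; exact: om0.
have Z0 : 0 < choice_weight om 1 n a.
  by rewrite /choice_weight big_nat prodr_gt0// => t /andP[t0 _]; exact: om0.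
by rewrite -[leRHS]expRK ler_ln ?posrE ?expR_gt0// ltW.
Qed.

Lemma ae_strong_law_upper (h : nat -> R) (e : R) : 0 < e -> (forall k, `|h k| <= 1) ->
  {ae P, forall w, let a := fun t => A t w in
    \forall n \near \oo,
    \sum_(1 <= t < n) (h (chosen_degree a t) - cond_mean f h a t) <= e * n%:R}.
Proof.
move=> e0 h1.
(* [l <= 1 / 2] brings [l * h k] into the range of [expR_le_quadratic]; [l <= e / 4] makes the
   correction [2 * l ^+ 2] at most half of [l * e]. *)
pose l : R := Num.min (1 / 2) (e / 4).
have l0 : 0 < l by rewrite lt_min; apply/andP; split; lra.
have [l2 le4] : l <= 1 / 2 /\ l <= e / 4 by split; rewrite ge_min lexx ?orbT.
pose om t a k := expR (l * (h k - cond_mean f h a t) - 2 * l ^+ 2).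
have e'0 : 0 < l * e / 2 by rewrite divr_gt0// mulr_gt0.
have om_le t a : (0 < t)%N -> valid_history a ->
    deg_sum (fun k => f k * om t a k) a t <= deg_sum f a t.
  move=> t0 _; rewrite cond_meanE// ler_piMl//.
    by rewrite ltW// deg_sum_gt0.
  set E := cond_mean f h a t.
  (* [c = expR (- x)] collects what does not depend on the degree; the remaining factor is bounded
     by a quantity of conditional mean [1 + x <= expR x]. *)
  pose c := expR (- (l * E + 2 * l ^+ 2)).
  apply: (@le_trans _ _ (cond_mean f (fun k => c * (1 + 2 * l ^+ 2 + l * h k)) a t)).
    apply: ler_cond_mean => // k k0.
    have -> : om t a k = c * expR (l * h k).
      by rewrite -expRD /om -/E; congr expR; ring.
    have hk := h1 k; rewrite ler_norml in hk; case/andP: hk => hk1 hk2.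
    rewrite ler_wpM2l ?expR_ge0// (le_trans (@expR_le_quadratic _ _ _))//; first by nra.
    have : h k ^+ 2 <= 1 by nra.
    have : 0 <= l ^+ 2 by rewrite sqr_ge0.
    by rewrite exprMn; nra.
  rewrite cond_meanZ cond_meanD cond_mean_cst// cond_meanZ -/E.
  rewrite /c expRN mulrC ler_pdivrMr ?expR_gt0// mul1r.
  apply: le_trans (expR_ge1Dx _); rewrite le_eqVlt; apply/orP; left; apply/eqP; ring.
apply: filterS (ae_sum_ln_weight e'0 (fun _ _ _ _ _ _ => expR_gt0 _) _ om_le); last first.
  by move=> t a b k ab; rewrite /om (eq_cond_mean_history _ _ ab).
move=> w /=; apply: filterS => n.
set a := fun t => A t w.
under eq_bigr do rewrite /om expRK.
rewrite sumrB -mulr_sumr sumr_const_nat -mulr_natl.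
set X := \sum_(_ <= _ < _) _ => H.
have n1 : (n - 1)%:R <= n%:R :> R by rewrite ler_nat leq_subr.
have : l * X <= l * (e * n%:R).
  have : 2 * l ^+ 2 * (n - 1)%:R <= l * e / 2 * n%:R.
    rewrite ler_pM ?mulr_ge0 ?sqr_ge0//; nra.
  lra.
by rewrite ler_pM2l.
Qed.

Lemma ae_strong_law (h : nat -> R) (e : R) : 0 < e -> (forall k, `|h k| <= 1) ->
  {ae P, forall w, let a := fun t => A t w in
    \forall n \near \oo, `|\sum_(1 <= t < n) h (chosen_degree a t)
      - \sum_(1 <= t < n) cond_mean f h a t| <= e * n%:R}.
Proof.
move=> e0 h1; have h1' k : `|-1 * h k| <= 1 by rewrite mulN1r normrN.
apply: filterS2 (ae_strong_law_upper e0 h1) (ae_strong_law_upper e0 h1').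
move=> w /=; apply: filterS2 => n; set a := fun t => A t w.
have E : \sum_(1 <= t < n) cond_mean f (fun k => -1 * h k) a t =
    -1 * \sum_(1 <= t < n) cond_mean f h a t.
  by rewrite mulr_sumr; apply: eq_bigr => t _; rewrite cond_meanZ.
rewrite !sumrB E -mulr_sumr ler_norml => u1 u2; apply/andP; split; lra.
Qed.

End strong_law.

(** * Deterministic growth lemmas *)

Section sequences.
Context (R : realType).
Implicit Types (u v X y : nat -> R).

Lemma sum_near_le u v (e : R) : 0 < e -> (\forall t \near \oo, u t <= v t) ->
  \forall n \near \oo, \sum_(1 <= t < n) u t <= \sum_(1 <= t < n) v t + e * n%:R.
Proof.
move=> e0 [N _ uv]; pose B := \sum_(1 <= t < N.+1) (u t - v t).
near=> n.
have Nn : (N.+1 <= n)%N by near: n; exact: nbhs_infty_ge.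
rewrite -lerBlDl -sumrB (big_cat_nat (n := N.+1))//=.
have : \sum_(N.+1 <= t < n) (u t - v t) <= 0.
  by rewrite big_nat sumr_le0// => t /andP[Nt _]; rewrite subr_le0 uv//= ltnW.
have : B / e <= n%:R by near: n; exact: nbhs_infty_ger.
rewrite ler_pdivrMr// mulrC /B; lra.
Unshelve. all: by end_near. Qed.

(** If [X n < c / 4 * n], monotonicity gives [X t <= c / 2 * t] for every [t] in the second half of
    [[1, n]], so [y t >= e * c / 2] there. At least [n / 4] such terms force the sum of [y], and
    with it [X n], to be linear. *)
Lemma linear_growth X y (c e : R) : 0 < c -> 0 < e ->
  (forall m n, (0 < m)%N -> (m <= n)%N -> X m <= X n) ->
  (forall t, (0 < t)%N -> 0 <= y t) ->
  (\forall t \near \oo, e * (c * t%:R - X t) <= y t * t%:R) ->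
  (\forall n \near \oo, \sum_(1 <= t < n) y t <= X n + c * e / 16 * n%:R) ->
  \forall n \near \oo, Num.min (c / 4) (c * e / 16) * n%:R <= X n.
Proof.
move=> c0 e0 X_le y0 [N _ yX] law.
have ce0 : 0 < c * e by rewrite mulr_gt0.
near=> n.
have n4 : 4 <= n%:R :> R by near: n; exact: nbhs_infty_ger.
have Nn : (N.*2 <= n)%N by near: n; exact: nbhs_infty_ge.
have lawn : \sum_(1 <= t < n) y t <= X n + c * e / 16 * n%:R by near: n.
have minl : Num.min (c / 4) (c * e / 16) <= c / 4 by rewrite ge_min lexx.
have minr : Num.min (c / 4) (c * e / 16) <= c * e / 16 by rewrite ge_min lexx orbT.
have [Xn|Xn] := leP (c / 4 * n%:R) (X n).
  by apply: le_trans Xn; rewrite ler_wpM2r.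
apply: (@le_trans _ _ (c * e / 16 * n%:R)); first by rewrite ler_wpM2r.
have yt t : (n./2.+1 <= t < n)%N -> e * c / 2 <= y t.
  move=> /andP[nt tn].
  have n2t : n%:R <= 2 * t%:R :> R by rewrite -natrM ler_nat; lia.
  have t0 : 0 < t%:R :> R by rewrite ltr0n; lia.
  have Xt : X t <= X n by apply: X_le; lia.
  have yXt : e * (c * t%:R - X t) <= y t * t%:R by apply: yX => /=; lia.
  rewrite -(ler_pM2r t0); apply: le_trans yXt.
  have -> : e * c / 2 * t%:R = e * (c / 2 * t%:R) by ring.
  by rewrite ler_pM2l//; nra.
have : (n - n./2.+1)%:R * (e * c / 2) <= \sum_(1 <= t < n) y t.
  rewrite (big_cat_nat (n := n./2.+1))//=; last by have : (4 <= n)%N; [by rewrite -(ler_nat R)|lia].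
  rewrite -[leLHS]add0r lerD//.
    by rewrite big_nat sumr_ge0// => t /andP[t0 _]; exact: y0.
  by rewrite mulr_natl -sumr_const_nat; exact: ler_sum_nat.
have : n%:R <= 4 * (n - n./2.+1)%:R :> R.
  have n4' : (4 <= n)%N by rewrite -(ler_nat R).
  by rewrite -natrM ler_nat; lia.
nra.
Unshelve. all: by end_near. Qed.

End sequences.

(** * Every degree is chosen linearly often *)

Section degree_counts.
Context {d : measure_display} {T : measurableType d} {R : realType}.
Context (P : probability T R) (f : nat -> R) (A : nat -> {RV P >-> nat}).
Hypothesis f_gt0 : forall k, (0 < k)%N -> 0 < f k.
Hypothesis f_nondecreasing : forall j k, (0 < j)%N -> (j <= k)%N -> f j <= f k.
Hypothesis A_pa : is_pa_tree f A.
Context (C : R).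
Hypothesis f_linear : forall k, (0 < k)%N -> f k <= C * k%:R.

Lemma linear_bound_gt0 : 0 < C.
Proof. by have := f_linear (k := 1) isT; rewrite mulr1; apply: lt_le_trans; exact: f_gt0. Qed.

Lemma deg_sum_linear_le a t : valid_history a -> deg_sum f a t <= 2 * C * t%:R.
Proof.
move=> va; apply: (@le_trans _ _ (C * deg_sum (fun k => k%:R) a t)).
  by rewrite -deg_sumZ; exact: ler_deg_sum.
by rewrite [2 * C]mulrC -mulrA ler_pM2l ?linear_bound_gt0// deg_sum_id.
Qed.

Lemma cond_mean_eq k a t :
  cond_mean f (fun j => (j == k)%:R) a t =
  f k * deg_sum (fun j => (j == k)%:R) a t / deg_sum f a t.
Proof.
rewrite /cond_mean -deg_sumZ; congr (_ / _); apply: eq_bigr => i _.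
by case: eqVneq => [->//|_]; rewrite !mulr0.
Qed.

Lemma deg_sum_eqE k a t :
  deg_sum (fun j => (j == k)%:R) a t =
  deg_sum (fun j => (k <= j)%:R) a t - deg_sum (fun j => (k < j)%:R) a t :> R.
Proof.
apply/esym/eqP; rewrite subr_eq -deg_sumD; apply/eqP; apply: eq_bigr => i _.
by rewrite leq_eqVlt eq_sym; case: ltngtP; rewrite ?addr0 ?add0r.
Qed.

Lemma deg_sum_gtE k a n : valid_history a -> (0 < k)%N ->
  deg_sum (fun j => (k < j)%:R) a n = \sum_(1 <= t < n) (chosen_degree a t == k)%:R :> R.
Proof.
move=> va k0; apply: (@deg_sum_telescope _ _ (fun j => (j == k)%:R)) => // [|j j0].
  by rewrite ltnNge k0.
by rewrite ltnS leq_eqVlt eq_sym; case: ltngtP; rewrite ?addr0 ?add0r.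
Qed.

(** The total weight is at most [2 * C * t] because the total degree is at most [2 * t]. *)
Lemma cond_mean_eq_ge k a t : (0 < k)%N -> (0 < t)%N -> valid_history a ->
  f k / (2 * C) * deg_sum (fun j => (j == k)%:R) a t <=
  cond_mean f (fun j => (j == k)%:R) a t * t%:R.
Proof.
move=> k0 t0 va; rewrite cond_mean_eq.
have S0 : 0 < deg_sum f a t by exact: deg_sum_gt0.
have := deg_sum_linear_le t va; have C0 := linear_bound_gt0.
set S := deg_sum f a t in S0 *; set N := deg_sum _ a t => S_le.
have N0 : 0 <= N by exact: deg_sum_ge0.
have inv_le : (2 * C)^-1 <= t%:R / S.
  by rewrite ler_pdivlMr// mulrC ler_pdivrMr ?mulr_gt0// mulrC.
rewrite mulrAC -[leRHS]mulrA [S^-1 * _]mulrC ler_wpM2l//.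
by rewrite mulr_ge0// ltW// f_gt0.
Qed.

(** Fact (a), by induction: the number of nodes of degree above [k] counts the choices at degree
    [k]. As long as it is small, the induction hypothesis leaves linearly many nodes of degree
    exactly [k], hence a positive rate; [linear_growth] concludes. *)
Lemma ae_deg_ge_linear k : (0 < k)%N -> exists2 c : R, 0 < c &
  {ae P, forall w, let a := fun t => A t w in
    \forall n \near \oo, c * n%:R <= deg_sum (fun j => (k <= j)%:R) a n}.
Proof.
elim: k => // -[_ _|k IH _].
  exists 1 => //; apply: aeW => w /=; apply: nearW => n.
  rewrite mul1r -[leLHS]mulr1 -(deg_sum_cst _ (fun t => A t w)) ler_deg_sum// => k ->.
  exact: lexx.
have [//|c c0 Hc] := IH.
set k' := k.+1 in IH Hc *.
have e0 : 0 < f k' / (2 * C) by rewrite divr_gt0 ?f_gt0 ?mulr_gt0 ?linear_bound_gt0.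
exists (Num.min (c / 4) (c * (f k' / (2 * C)) / 16)).
  by rewrite lt_min !divr_gt0// mulr_gt0.
have h1 j : `|(j == k')%:R : R| <= 1 by rewrite normr_nat lern1 leq_b1.
apply: filterS2 Hc (ae_strong_law f_gt0 A_pa (divr_gt0 (mulr_gt0 c0 e0) (ltr0n R 16)) h1).
move=> w /=; set a := fun t => A t w => Hc Hlaw.
have va : valid_history a by exact: pa_valid A_pa w.
apply: (@linear_growth _ _ (cond_mean f (fun j => (j == k')%:R) a)) => //.
- move=> m n m0 mn; rewrite !deg_sum_gtE// [leRHS](big_cat_nat (n := m))//= lerDl.
  by rewrite sumr_ge0.
- by move=> t t0; exact: cond_mean_ge0.
- near=> t; have t0 : (0 < t)%N by near: t; exact: nbhs_infty_gt.
  apply: le_trans (cond_mean_eq_ge _ t0 va) => //; rewrite ler_pM2l// deg_sum_eqE.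
  by rewrite lerD2r; near: t.
- apply: filterS Hlaw => n; rewrite deg_sum_gtE// ler_norml => /andP[+ _]; lra.
Unshelve. all: by end_near. Qed.

(** The number of leaves grows by one exactly when a non-leaf is chosen. Since [f] is smallest at 1,
    a leaf is chosen with probability at most the proportion of leaves, so scarce leaves grow
    fast. *)
Lemma ae_leaves_linear : exists2 c : R, 0 < c &
  {ae P, forall w, let a := fun t => A t w in
    \forall n \near \oo, c * n%:R <= deg_sum (fun j => (j == 1%N)%:R) a n}.
Proof.
exists (Num.min (1 / 4) (1 * 1 / 16)); first by rewrite lt_min; apply/andP; split; lra.
have h1 j : `|(j == 1%N)%:R : R| <= 1 by rewrite normr_nat lern1 leq_b1.
have e0 : 0 < 1 * 1 / 16 :> R by lra.
apply: filterS (ae_strong_law f_gt0 A_pa e0 h1) => w /=.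
set a := fun t => A t w => law.
have va : valid_history a by exact: pa_valid A_pa w.
have E n : deg_sum (fun j => (j == 1%N)%:R) a n =
    n%:R - \sum_(1 <= t < n) (chosen_degree a t == 1%N)%:R :> R.
  rewrite deg_sumE// mulr1 -sumrN; congr (_ + _); apply: eq_bigr => t _.
  by rewrite eqSS eqn0Ngt degree_gt0 sub0r.
apply: (@linear_growth _ _ (fun t => 1 - cond_mean f (fun j => (j == 1%N)%:R) a t)) => //.
- move=> m n m0 mn; rewrite !E [X in _ <= _ - X](big_cat_nat (n := m))//=.
  have : \sum_(m <= t < n) (chosen_degree a t == 1%N)%:R <= (n - m)%:R :> R.
    rewrite -[leRHS]mulr1 mulr_natl -sumr_const_nat.
    by apply: ler_sum => t _; rewrite lern1 leq_b1.
  by rewrite natrB//; lra.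
- by move=> t t0; rewrite subr_ge0 cond_mean_le1// => k k0; rewrite lern1 leq_b1.
- near=> t; have t0 : (0 < t)%N by near: t; exact: nbhs_infty_gt.
  rewrite !mul1r mulrBl mul1r lerD2l lerN2 cond_mean_eq mulrAC.
  rewrite ler_pdivrMr ?deg_sum_gt0// mulrAC [leRHS]mulrC ler_wpM2r ?deg_sum_ge0//.
  by rewrite mulrC deg_sum_ge.
- apply: filterS law => n; rewrite E sumrB sumr_const_nat => /ler_normlP[_].
  have : (n - 1)%:R <= n%:R :> R by rewrite ler_nat leq_subr.
  lra.
Unshelve. all: by end_near. Qed.

End degree_counts.

(** * Contraction argument and logarithmic weights *)

Section tail_weight.
Context (R : realType).
Implicit Types (X y : nat -> R).

(** A bound [X n <= b * n] improves itself to [rho * b + 3 * e]: one [e] from each of the two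
    hypotheses and one for the finitely many exceptional times. Iterating this contraction from the
    trivial bound approaches its fixed point [3 * e / (1 - rho)]. *)
Lemma iterated_bound X y (rho e : R) : 0 <= rho < 1 -> 0 < e ->
  (forall n, X n <= n%:R) ->
  (\forall t \near \oo, y t * t%:R <= rho * X t + e * t%:R) ->
  (\forall n \near \oo, X n <= \sum_(1 <= t < n) y t + e * n%:R) ->
  \forall n \near \oo, X n <= 4 * e / (1 - rho) * n%:R.
Proof.
move=> /andP[rho0 rho1] e0 Xn Hy HX.
have r0 : 0 < 1 - rho by rewrite subr_gt0.
have step b : 0 <= b -> (\forall t \near \oo, X t <= b * t%:R) ->
    \forall n \near \oo, X n <= (rho * b + 3 * e) * n%:R.
  move=> b0 Hb; set v := rho * b + e.
  have yv : \forall t \near \oo, y t <= v.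
    near=> t; have t0 : 0 < t%:R :> R by rewrite ltr0n; near: t; exact: nbhs_infty_gt.
    have yt : y t * t%:R <= rho * X t + e * t%:R by near: t.
    have Xt : X t <= b * t%:R by near: t.
    rewrite -(ler_pM2r t0) (le_trans yt)// mulrDl lerD2r -mulrA.
    exact: ler_wpM2l.
  apply: filterS2 HX (sum_near_le e0 yv) => n; rewrite sumr_const_nat -mulr_natl.
  have : (n - 1)%:R * v <= n%:R * v.
    by rewrite ler_wpM2r ?ler_nat ?leq_subr// addr_ge0 ?mulr_ge0// ltW.
  rewrite /v; lra.
have iter j : \forall n \near \oo, X n <= (3 * e / (1 - rho) + rho ^+ j) * n%:R.
  elim: j => [|j /step IH].
    apply: nearW => n; apply: le_trans (Xn n) _.
    rewrite -[leLHS]mul1r ler_wpM2r// lerDr divr_ge0// ?mulr_ge0// ltW//.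
  apply: filterS (IH _) => [n|]; last first.
    by rewrite addr_ge0 ?exprn_ge0// divr_ge0// ?mulr_ge0// ltW.
  rewrite exprS; congr (_ <= _ * _).
  by field; rewrite gt_eqF.
have [j rj] : exists j, rho ^+ j <= e / (1 - rho).
  have q0 : 0 < e / (1 - rho) by rewrite divr_gt0.
  have : `|rho| < 1 by rewrite ger0_norm.
  move/cvg_expr/cvgrPdist_le => /(_ _ q0)[N _ HN]; exists N.
  by have := HN N (leqnn N); rewrite sub0r normrN ger0_norm// exprn_ge0.
apply: filterS (iter j) => n Xj; apply: le_trans Xj _.
rewrite ler_wpM2r//.
have -> : 4 * e / (1 - rho) = 3 * e / (1 - rho) + e / (1 - rho) by ring.
by rewrite lerD2l.
Unshelve. all: by end_near. Qed.

(* The slow growth of log makes [log_weight M k * k] exceed its own sum over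
   l < k by only 2 k / M: this is what turns the linear attachment rule into a
   contraction for [log_weight_sum]. *)
Definition log_weight (M : R) (k : nat) : R := Num.min (ln k%:R / M) 1.

Definition log_weight_sum (M : R) (k : nat) : R := \sum_(1 <= l < k) log_weight M l.

Lemma log_weight_ge0 M k : 0 < M -> 0 <= log_weight M k.
Proof.
move=> M0; rewrite le_min ler01 andbT; case: k => [|k].
  by rewrite ln0// mul0r.
by rewrite divr_ge0 ?(ltW M0)// ln_ge0// ler1n.
Qed.

Lemma log_weight_le1 M k : log_weight M k <= 1.
Proof. by rewrite ge_min lexx orbT. Qed.

Lemma log_weight_le M k : log_weight M k <= ln k%:R / M.
Proof. by rewrite ge_min lexx. Qed.

Lemma log_weight_sum_ge0 M k : 0 < M -> 0 <= log_weight_sum M k.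
Proof. by move=> M0; apply: sumr_ge0 => l _; exact: log_weight_ge0. Qed.

Lemma log_weight_sumS M k : (0 < k)%N ->
  log_weight_sum M k.+1 = log_weight_sum M k + log_weight M k.
Proof. by move=> k0; rewrite /log_weight_sum big_nat_recr. Qed.

Lemma log_weightS M k : 0 < M -> (0 < k)%N ->
  log_weight M k.+1 - log_weight M k <= (k%:R * M)^-1.
Proof.
move=> M0 k0; have k0' : 0 < k%:R :> R by rewrite ltr0n.
rewrite {2}/log_weight; have [lk|lk] := leP (ln k%:R / M) 1; last first.
  rewrite (@le_trans _ _ 0) ?subr_le0 ?log_weight_le1//.
  by rewrite invr_ge0 ltW// mulr_gt0.
apply: (@le_trans _ _ (ln k.+1%:R / M - ln k%:R / M)).
  by rewrite lerD2r log_weight_le.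
rewrite -mulrBl invfM ler_wpM2r ?invr_ge0 ?(ltW M0)//.
rewrite -ln_div ?posrE ?ltr0n// -natr1 mulrDl divff ?gt_eqF// mul1r.
by rewrite le_ln1Dx// (lt_trans (ltrN10 _))// invr_gt0.
Qed.

(** Summation by parts: from [k] to [k + 1] the difference of [k * log_weight M k] and
    [log_weight_sum M k] grows by [k + 1] times an increment of the weight, hence by at most
    [2 / M]. *)
Lemma mul_log_weight_le M k : 0 < M -> (0 < k)%N ->
  k%:R * log_weight M k <= log_weight_sum M k + 2 * k%:R / M.
Proof.
move=> M0; elim: k => // -[_ _|k IH _].
  have : log_weight M 1 <= 0 by rewrite (le_trans (log_weight_le _ _))// ln1 mul0r.
  rewrite mul1r => /le_trans; apply.
  by rewrite addr_ge0 ?log_weight_sum_ge0// divr_ge0// ltW.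
have := IH isT; have := @log_weightS M k.+1 M0 isT.
rewrite (@log_weight_sumS M k.+1)// => dS le.
have k0 : 0 < k.+1%:R :> R by rewrite ltr0n.
have : k.+2%:R * (log_weight M k.+2 - log_weight M k.+1) <= 2 / M.
  apply: (@le_trans _ _ (k.+2%:R * (k.+1%:R * M)^-1)); first exact: ler_wpM2l.
  rewrite invfM mulrA ler_wpM2r ?invr_ge0 ?(ltW M0)//.
  by rewrite ler_pdivrMr// -natrM ler_nat; lia.
rewrite -[k.+2%:R]natr1; lra.
Qed.

(** Lets [log_weight_sum] dominate large degrees: the weight is 1 from [expR M] on, and [M >= 4]
    lets the error [2 * k / M] be absorbed. *)
Lemma le_log_weight_sum M k : 4 <= M -> expR M <= k%:R ->
  k%:R <= 2 * log_weight_sum M k.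
Proof.
move=> M4 Mk; have M0 : 0 < M by lra.
have k0 : 0 < k%:R :> R by rewrite (lt_le_trans (expR_gt0 M)).
have w1 : log_weight M k = 1.
  rewrite /log_weight min_r// ler_pdivlMr// mul1r -[leLHS]expRK.
  by rewrite ler_ln ?posrE ?expR_gt0.
have k0' : (0 < k)%N by rewrite -(ltr0n R).
have := mul_log_weight_le M0 k0'; rewrite w1 mulr1.
have : 2 * k%:R / M <= k%:R / 2.
  rewrite ler_pdivrMr//; nra.
lra.
Qed.

End tail_weight.

(** * Uniform smallness of the degree carried by large-degree nodes *)

Section uniform_integrability.
Context {d : measure_display} {T : measurableType d} {R : realType}.
Context (P : probability T R) (f : nat -> R) (A : nat -> {RV P >-> nat}).
Hypothesis f_gt0 : forall k, (0 < k)%N -> 0 < f k.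
Hypothesis A_pa : is_pa_tree f A.

(** Fact (b) for both growth regimes: [kappa] is the linear slope of [f] and [s] a lower bound for
    the mean weight per node, so [log_weight_sum] summed over the nodes obeys [iterated_bound] with
    ratio [kappa / s < 1]. *)
Lemma ae_tail_weight (kappa s c tau : R) : 0 <= kappa < s -> 0 <= c ->
  (forall (M : R) k, 0 < M -> (0 < k)%N ->
    f k * log_weight M k <= kappa * log_weight_sum M k + c / M * k%:R) ->
  (forall a, valid_history a -> \forall t \near \oo, s * t%:R <= deg_sum f a t) ->
  0 < tau ->
  exists K, {ae P, forall w, let a := fun t => A t w in
    \forall n \near \oo, deg_sum (fun k => k%:R * (K < k)%:R) a n <= tau * n%:R}.
Proof.
move=> /andP[kappa0 ks] c0 drift S_ge tau0.
have s0 : 0 < s by exact: le_lt_trans ks.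
pose rho := kappa / s.
have rho01 : 0 <= rho < 1.
  by rewrite divr_ge0 ?(ltW s0)//= ltr_pdivrMr// mul1r.
have r0 : 0 < 1 - rho by rewrite subr_gt0; case/andP: rho01.
(* Chosen so that twice the final bound [4 * e / (1 - rho)] is [tau]; [M] then makes the drift error
   [2 * c / (M * s)] at most [e]. *)
pose e := tau * (1 - rho) / 8.
have e0 : 0 < e by rewrite divr_gt0// mulr_gt0.
pose M : R := Num.max 4 (2 * c / (s * e)).
have [M4 Mc] : 4 <= M /\ 2 * c / (s * e) <= M by split; rewrite le_max lexx ?orbT.
have M0 : 0 < M by lra.
exists (Num.bound (expR M)).
have h1 k : `|log_weight M k| <= 1 by rewrite ger0_norm ?log_weight_ge0 ?log_weight_le1.
apply: filterS (ae_strong_law f_gt0 A_pa e0 h1) => w /=.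
set a := fun t => A t w => law.
have va : valid_history a by exact: pa_valid A_pa w.
have XE n : deg_sum (log_weight_sum M) a n = \sum_(1 <= t < n) log_weight M (chosen_degree a t).
  apply: deg_sum_telescope => // [|k k0]; first by rewrite /log_weight_sum big_geq.
  exact: log_weight_sumS.
have X_le n : deg_sum (log_weight_sum M) a n <= n%:R.
  rewrite XE (@le_trans _ _ (n - 1)%:R) ?ler_nat ?leq_subr//.
  rewrite -[leRHS]mulr1 mulr_natl -sumr_const_nat.
  by apply: ler_sum => t _; exact: log_weight_le1.
have X_law : \forall n \near \oo, deg_sum (log_weight_sum M) a n <=
    \sum_(1 <= t < n) cond_mean f (log_weight M) a t + e * n%:R.
  by apply: filterS law => n; rewrite XE => /ler_normlP[_]; lra.
have y_le : \forall t \near \oo, cond_mean f (log_weight M) a t * t%:R <=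
    rho * deg_sum (log_weight_sum M) a t + e * t%:R.
  near=> t; have t0 : (0 < t)%N by near: t; exact: nbhs_infty_gt.
  have St : s * t%:R <= deg_sum f a t by near: t; exact: S_ge.
  have t0' : 0 < t%:R :> R by rewrite ltr0n.
  have := deg_sum_id R t va; have S0 := deg_sum_gt0 a t0 f_gt0.
  have : deg_sum (fun k => f k * log_weight M k) a t <=
      kappa * deg_sum (log_weight_sum M) a t + c / M * deg_sum (fun k => k%:R) a t.
    by rewrite -!deg_sumZ -deg_sumD; apply: ler_deg_sum => k k0; exact: drift.
  have X0 : 0 <= deg_sum (log_weight_sum M) a t.
    by apply: deg_sum_ge0 => k _; exact: log_weight_sum_ge0.
  have D0 : 0 <= deg_sum (fun k => f k * log_weight M k) a t.
    by apply: deg_sum_ge0 => k k0; rewrite mulr_ge0 ?log_weight_ge0// ltW// f_gt0.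
  rewrite /cond_mean; move: X0 D0 S0 St.
  set X := deg_sum (log_weight_sum M) a t; set S := deg_sum f a t.
  set D := deg_sum _ a t; set I := deg_sum _ a t => X0 D0 S0 St D_le I_le.
  apply: (@le_trans _ _ (D / s)).
    rewrite mulrAC ler_pdivrMr// -mulrA ler_wpM2l//.
    by rewrite mulrC ler_pdivlMr// mulrC.
  rewrite ler_pdivrMr// (le_trans D_le)// mulrDl.
  have -> : rho * X * s = kappa * X by rewrite /rho; field; rewrite gt_eqF.
  rewrite lerD2l (@le_trans _ _ (c / M * (2 * t%:R)))//.
    by rewrite ler_wpM2l// divr_ge0// ltW.
  have -> : c / M * (2 * t%:R) = 2 * c / M * t%:R by ring.
  rewrite [leRHS]mulrAC ler_wpM2r// ler_pdivrMr//.
  by rewrite -ler_pdivrMl ?mulr_gt0// mulrC [e * s]mulrC.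
apply: filterS (iterated_bound rho01 e0 X_le y_le X_law) => n Xn.
apply: (@le_trans _ _ (2 * deg_sum (log_weight_sum M) a n)).
  rewrite -deg_sumZ; apply: ler_deg_sum => k k0.
  case: ltnP => Kk; last by rewrite mulr0 mulr_ge0// log_weight_sum_ge0.
  rewrite mulr1 le_log_weight_sum// (le_trans (ltW (archi_boundP (expR_ge0 M))))//.
  by rewrite ler_nat ltnW.
rewrite -ler_pdivlMl// (le_trans Xn)// [leRHS]mulrA ler_wpM2r// /e.
rewrite le_eqVlt; apply/orP; left; apply/eqP.
by field; rewrite gt_eqF.
Unshelve. all: by end_near. Qed.

(** Here [kappa = 0]: since [ln k] is at most [k ^ (1 - beta) / (1 - beta)], the weighted [f] is at
    most linear with a factor [1 / M]. *)
Lemma ae_tail_sublinear (C beta tau : R) :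
  (forall j k, (0 < j)%N -> (j <= k)%N -> f j <= f k) -> beta < 1 ->
  (forall k, (0 < k)%N -> f k <= C * k%:R `^ beta) -> 0 < tau ->
  exists K, {ae P, forall w, let a := fun t => A t w in
    \forall n \near \oo, deg_sum (fun k => k%:R * (K < k)%:R) a n <= tau * n%:R}.
Proof.
move=> f_le beta1 f_growth.
have C0 : 0 < C.
  by have := f_growth 1%N isT; rewrite powR1 mulr1; apply: lt_le_trans; exact: f_gt0.
have b0 : 0 < 1 - beta by rewrite subr_gt0.
apply: (@ae_tail_weight 0 (f 1%N) (C / (1 - beta))).
- by rewrite lexx f_gt0.
- by rewrite ltW// divr_gt0.
- move=> M k M0 k0; rewrite mul0r add0r.
  have k0' : 0 < k%:R :> R by rewrite ltr0n.
  have lnk : ln k%:R <= k%:R `^ (1 - beta) / (1 - beta).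
    by rewrite ler_pdivlMr// mulrC -ln_powR ltW// ln_sublinear// powR_gt0.
  apply: (@le_trans _ _ (C * k%:R `^ beta * (k%:R `^ (1 - beta) / (1 - beta) / M))).
    rewrite ler_pM ?log_weight_ge0 ?(ltW (f_gt0 _)) ?f_growth//.
    by rewrite (le_trans (log_weight_le _ _))// ler_wpM2r// invr_ge0 ltW.
  rewrite le_eqVlt; apply/orP; left; apply/eqP.
  have : k%:R `^ beta * k%:R `^ (1 - beta) = k%:R.
    by rewrite -powRD ?subrKC ?powRr1// ?(ltW k0')// (gt_eqF k0') implybT.
  move=> {3}<-; ring.
- move=> a va; near=> t; have t0 : (0 < t)%N by near: t; exact: nbhs_infty_gt.
  by rewrite mulrC deg_sum_ge.
Unshelve. all: by end_near. Qed.

(** Here the slope is 1 and the total weight is [(2 + alpha) * t - 1]. As [alpha > -1], the value of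
    [s] lies strictly between 1 and [2 + alpha]. *)
Lemma ae_tail_affine (alpha tau : R) : -1 < alpha ->
  (forall k, (0 < k)%N -> f k = k%:R + alpha) -> 0 < tau ->
  exists K, {ae P, forall w, let a := fun t => A t w in
    \forall n \near \oo, deg_sum (fun k => k%:R * (K < k)%:R) a n <= tau * n%:R}.
Proof.
move=> alpha1 fE.
apply: (@ae_tail_weight 1 (1 + (1 + alpha) / 2) (2 + `|alpha|)).
- by rewrite ler01/=; lra.
- by rewrite addr_ge0.
- move=> M k M0 k0; rewrite mul1r fE// mulrDl.
  have := mul_log_weight_le M0 k0.
  have : alpha * log_weight M k <= `|alpha| / M * k%:R.
    apply: (@le_trans _ _ (`|alpha| * log_weight M k)).
      by rewrite ler_wpM2r ?log_weight_ge0// ler_norm.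
    rewrite -mulrA ler_wpM2l// (le_trans (log_weight_le _ _))// mulrC.
    by rewrite ler_wpM2l ?invr_ge0 ?(ltW M0)// ltW// ln_sublinear// ltr0n.
  lra.
- move=> a va; near=> t; have t0 : (0 < t)%N by near: t; exact: nbhs_infty_gt.
  rewrite (@eq_deg_sum _ _ (fun k => k%:R + alpha))// deg_sumD deg_sum_cst deg_sumE//.
  under eq_bigr do rewrite -natr1 addrC addKr.
  rewrite sumr_const_nat natrB// mulr1.
  have : 1 / ((1 + alpha) / 2) <= t%:R by near: t; exact: nbhs_infty_ger.
  rewrite ler_pdivrMr; last by lra.
  lra.
Unshelve. all: by end_near. Qed.

End uniform_integrability.

(** * The envelope of the one-step likelihood ratios *)

(* Throughout, f is the true attachment function, h a competitor, and the
   envelope bounds all the functions close to h on {1, ..., K} and of linear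
   growth with constant C. *)
Section envelope.
Context (R : realType) (f h : nat -> R) (C r : R) (K : nat).
Hypothesis f_gt0 : forall k, (0 < k)%N -> 0 < f k.
Hypothesis h_gt0 : forall k, (0 < k)%N -> 0 < h k.
Hypothesis h_nondecreasing : forall j k, (0 < j)%N -> (j <= k)%N -> h j <= h k.
Hypothesis C_gt0 : 0 < C.
Hypothesis r_ge1 : 1 <= r.
Hypothesis K_gt0 : (0 < K)%N.
Implicit Types (a : nat -> nat) (t k : nat).

Definition envelope k : R := if (k <= K)%N then r * h k else C * k%:R.

(** [amplitude] and [scale] are the degree-dependent and the past-dependent factor of the square
    root of the bound W. *)
Definition amplitude k : R := Num.sqrt (envelope k / f k).

(** Closeness to [h] is available up to [K]; capping the degrees there yields, by monotonicity, a
    lower bound for the total weights of all neighbouring functions. *)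
Definition truncated_sum a t : R := deg_sum (fun k => h (minn k K)) a t.

Definition scale a t : R := Num.sqrt (r * deg_sum f a t / truncated_sum a t).

Let r_gt0 : 0 < r. Proof. exact: lt_le_trans r_ge1. Qed.

Lemma envelope_gt0 k : (0 < k)%N -> 0 < envelope k.
Proof.
by move=> k0; rewrite /envelope; case: ifP => _; rewrite mulr_gt0 ?h_gt0 ?ltr0n.
Qed.

Lemma amplitude_gt0 k : (0 < k)%N -> 0 < amplitude k.
Proof. by move=> k0; rewrite sqrtr_gt0 divr_gt0 ?f_gt0 ?envelope_gt0. Qed.

Lemma truncated_sum_gt0 a t : (0 < t)%N -> 0 < truncated_sum a t.
Proof. by move=> t0; apply: deg_sum_gt0 => // k k0; rewrite h_gt0// leq_min k0. Qed.

Lemma scale_gt0 a t : (0 < t)%N -> 0 < scale a t.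
Proof.
move=> t0; rewrite sqrtr_gt0 divr_gt0 ?truncated_sum_gt0//.
by rewrite mulr_gt0 ?deg_sum_gt0.
Qed.

Lemma sqr_amplitude k : (0 < k)%N -> amplitude k ^+ 2 = envelope k / f k.
Proof. by move=> k0; rewrite sqr_sqrtr// ltW// divr_gt0 ?envelope_gt0 ?f_gt0. Qed.

Lemma sqr_scale a t : (0 < t)%N ->
  scale a t ^+ 2 = r * deg_sum f a t / truncated_sum a t.
Proof.
move=> t0; rewrite sqr_sqrtr// ltW// divr_gt0 ?truncated_sum_gt0//.
by rewrite mulr_gt0 ?deg_sum_gt0.
Qed.

Lemma eq_scale_history a b t : (forall s, (0 < s < t)%N -> a s = b s) ->
  scale a t = scale b t.
Proof.
by move=> ab; rewrite /scale /truncated_sum !(eq_deg_sum_history _ ab).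
Qed.

Lemma ln_likelihood_ratio_le (g : nat -> R) a t k : (0 < t)%N -> (0 < k)%N ->
  (forall j, (0 < j)%N -> 0 < g j) ->
  (forall i j, (0 < i)%N -> (i <= j)%N -> g i <= g j) ->
  (forall j, (0 < j <= K)%N -> g j <= r * h j /\ h j <= r * g j) ->
  (forall j, (0 < j)%N -> g j <= C * j%:R) ->
  (ln (g k) - ln (deg_sum g a t)) - (ln (f k) - ln (deg_sum f a t)) <=
  2 * ln (scale a t * amplitude k).
Proof.
move=> t0 k0 g0 g_le gh gC.
have S0 := truncated_sum_gt0 a t0; have Sg0 := deg_sum_gt0 a t0 g0.
have Sf0 := deg_sum_gt0 a t0 f_gt0; have fk0 := f_gt0 k0; have gk0 := g0 k k0.
rewrite mulr_natl -lnXn ?mulr_gt0 ?scale_gt0 ?amplitude_gt0// exprMn.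
rewrite sqr_scale// sqr_amplitude//.
have fS0 : 0 < f k / deg_sum f a t by rewrite divr_gt0.
have gS0 : 0 < g k / deg_sum g a t by rewrite divr_gt0.
rewrite -!ln_div ?posrE// ler_ln ?posrE ?mulr_gt0 ?invr_gt0 ?envelope_gt0//.
have gF : g k <= envelope k.
  by rewrite /envelope; case: leqP => kK; rewrite ?gC// (gh _ _).1// k0.
have TS : truncated_sum a t <= r * deg_sum g a t.
  rewrite -deg_sumZ; apply: ler_deg_sum => j j0.
  have j1 : (0 < minn j K)%N by rewrite leq_min j0.
  apply: (@le_trans _ _ (r * g (minn j K))).
    by apply: (gh _ _).2; rewrite j1 geq_minr.
  by rewrite ler_pM2l// g_le// geq_minl.
have -> : g k / deg_sum g a t / (f k / deg_sum f a t) =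
    (g k / f k) * (deg_sum f a t / deg_sum g a t).
  by field; rewrite !gt_eqF.
rewrite [leRHS]mulrC ler_pM ?divr_ge0 ?(ltW gk0) ?(ltW fk0) ?(ltW Sf0) ?(ltW Sg0)//.
  by rewrite ler_pM2r ?invr_gt0.
rewrite ler_pdivlMr// mulrAC ler_pdivrMr//.
by rewrite [r * _]mulrC -mulrA ler_pM2l.
Qed.

(** The factor [f] cancels, leaving the ratio of the sums of [envelope] and of the capped [h]. They
    differ by the factor [r] and by the tail above [K], which is compared with
    [truncated_sum a t >= t * h 1]. *)
Lemma cond_mean_amplitude_sqr_le a t tau : (0 < t)%N ->
  deg_sum (fun k => k%:R * (K < k)%:R) a t <= tau * t%:R ->
  scale a t ^+ 2 * cond_mean f (fun k => amplitude k ^+ 2) a t <=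
  r ^+ 2 + r * C * tau / h 1.
Proof.
move=> t0 tail.
have S0 := truncated_sum_gt0 a t0; have Sf0 := deg_sum_gt0 a t0 f_gt0.
rewrite sqr_scale// /cond_mean.
have -> : deg_sum (fun k => f k * amplitude k ^+ 2) a t = deg_sum envelope a t.
  apply: eq_deg_sum => k k0; have fk0 := f_gt0 k0.
  by rewrite sqr_amplitude// mulrC divfK// gt_eqF.
have le : deg_sum envelope a t <= r * truncated_sum a t + C * (tau * t%:R).
  apply: (@le_trans _ _ (r * truncated_sum a t +
      C * deg_sum (fun k => k%:R * (K < k)%:R) a t)); last first.
    by rewrite lerD2l ler_pM2l.
  rewrite -!deg_sumZ -deg_sumD; apply: ler_deg_sum => k k0; rewrite /envelope.
  case: leqP => kK.
    by rewrite mulr0 mulr0 addr0 lexx.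
  by rewrite mulr1 lerDr mulr_ge0// ltW// h_gt0// leq_min k0.
have hT : t%:R * h 1 <= truncated_sum a t.
  rewrite -(deg_sum_cst _ a); apply: ler_deg_sum => k k0.
  by rewrite h_nondecreasing// leq_min k0.
have h10 : 0 < h 1 by exact: h_gt0.
have -> : r * deg_sum f a t / truncated_sum a t * (deg_sum envelope a t / deg_sum f a t) =
    r * (deg_sum envelope a t / truncated_sum a t).
  by field; rewrite !gt_eqF.
have -> : r ^+ 2 + r * C * tau / h 1 = r * (r + C * tau / h 1) by ring.
rewrite ler_pM2l// ler_pdivrMr// (le_trans le)// mulrDl lerD2l.
have tau0 : 0 <= tau.
  rewrite -(@ler_pM2r _ t%:R) ?ltr0n// mul0r (le_trans _ tail)// deg_sum_ge0// => k _.
rewrite mulrA -[leRHS]mulrA [_^-1 * _]mulrC ler_wpM2l ?mulr_ge0 ?(ltW C_gt0)//.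
by rewrite ler_pdivlMr.
Qed.

(* The point of [mu]: the ratio [amplitude k0 / amplitude 1] depends neither on
   r nor on the past, so [scale * amplitude] cannot be close to 1 at both
   degrees. *)
Lemma cond_mean_amplitude_le a t k0 mu c tau : (0 < t)%N -> (1 < k0)%N -> 0 <= c ->
  amplitude k0 = mu * amplitude 1 ->
  c <= cond_mean f (fun k => (k == 1%N)%:R) a t ->
  deg_sum (fun k => k%:R * (K < k)%:R) a t <= tau * t%:R ->
  2 * (scale a t * cond_mean f amplitude a t - 1) <=
  r ^+ 2 - 1 + r * C * tau / h 1 -
  (mu - 1) ^+ 2 / (1 + mu ^+ 2) * c * cond_mean f (fun k => (k == k0)%:R) a t.
Proof.
move=> t0 k01 c0 ampk0 cq1 tail.
have sqr_le := cond_mean_amplitude_sqr_le t0 tail.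
set s := scale a t in sqr_le *.
set q1 := cond_mean f (fun k => (k == 1%N)%:R) a t in cq1 *.
set q := cond_mean f (fun k => (k == k0)%:R) a t.
pose u := s * amplitude 1 - 1; pose v := s * amplitude k0 - 1.
(* In [2 * z = z ^+ 2 + 1 - (z - 1) ^+ 2] with [z = s * amplitude k], the last square is kept at the
   degrees 1 and [k0] and dropped elsewhere. *)
have le : cond_mean f (fun k => 2 * s * amplitude k) a t <=
    cond_mean f (fun k => (s ^+ 2 * amplitude k ^+ 2 + 1) +
      (- u ^+ 2 * (k == 1%N)%:R + - v ^+ 2 * (k == k0)%:R)) a t.
  apply: ler_cond_mean => // k _.
  have [->|k1] := eqVneq k 1%N.
    rewrite [1%N == _]ltn_eqF// /u mulr1 mulr0; lra.
  have [->|kk0] := eqVneq k k0.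
    rewrite /v mulr1 mulr0; lra.
  rewrite !mulr0 !addr0 -subr_ge0.
  by have := sqr_ge0 (s * amplitude k - 1); lra.
move: le; rewrite !cond_meanD !cond_meanZ cond_mean_cst// -/q1 -/q => le.
have q01 : 0 <= q <= 1.
  by rewrite cond_mean_ge0//= cond_mean_le1// => k _; rewrite lern1 leq_b1.
have q101 : q1 <= 1.
  by rewrite cond_mean_le1// => k _; rewrite lern1 leq_b1.
(* Cauchy-Schwarz applied to [mu - 1 = v - mu * u]. *)
have uv : (mu - 1) ^+ 2 / (1 + mu ^+ 2) <= u ^+ 2 + v ^+ 2.
  rewrite ler_pdivrMr; last by rewrite ltr_pwDl// sqr_ge0.
  have -> : mu - 1 = v - mu * u by rewrite /u /v ampk0; ring.
  have := sqr_ge0 (u + mu * v).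
  lra.
have : (u ^+ 2 + v ^+ 2) * (c * q) <= u ^+ 2 * q1 + v ^+ 2 * q.
  case/andP: q01 => q0 q1'; rewrite mulrDl lerD// ler_wpM2l ?sqr_ge0//; nra.
have : (mu - 1) ^+ 2 / (1 + mu ^+ 2) * (c * q) <= (u ^+ 2 + v ^+ 2) * (c * q).
  by apply: ler_wpM2r => //; case/andP: q01 => q0 _; rewrite mulr_ge0.
rewrite -[X in _ -> _ -> _ <= _ - X]mulrA.
lra.
Qed.

End envelope.

(** * Local separation of the log-likelihoods *)

Section separation.
Context {d : measure_display} {T : measurableType d} {R : realType}.
Context (P : probability T R) (f h : nat -> R) (A : nat -> {RV P >-> nat}).
Hypothesis f_gt0 : forall k, (0 < k)%N -> 0 < f k.
Hypothesis f_nondecreasing : forall j k, (0 < j)%N -> (j <= k)%N -> f j <= f k.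
Hypothesis A_pa : is_pa_tree f A.
Context (C : R).
Hypothesis f_linear : forall k, (0 < k)%N -> f k <= C * k%:R.
Hypothesis f_tail : forall tau : R, 0 < tau ->
  exists K, {ae P, forall w, let a := fun t => A t w in
    \forall n \near \oo, deg_sum (fun k => k%:R * (K < k)%:R) a n <= tau * n%:R}.
Hypothesis h_gt0 : forall k, (0 < k)%N -> 0 < h k.
Hypothesis h_nondecreasing : forall j k, (0 < j)%N -> (j <= k)%N -> h j <= h k.

(** The exceptional null set and the threshold on [n] must not depend on [g], because [g] will be
    given by the random estimator; the weights below are built from [h], [r] and [K] alone. *)
Lemma ae_loglik_lt k0 C' : (1 < k0)%N -> h k0 / f k0 != h 1 / f 1 -> 0 < C' ->
  exists (r : R) (K : nat), 1 < r /\
  {ae P, forall w, let a := fun t => A t w in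
    \forall n \near \oo, forall g : nat -> R,
    (forall k, (0 < k)%N -> 0 < g k) ->
    (forall j k, (0 < j)%N -> (j <= k)%N -> g j <= g k) ->
    (forall k, (0 < k <= K)%N -> g k <= r * h k /\ h k <= r * g k) ->
    (forall k, (0 < k)%N -> g k <= C' * k%:R) ->
    loglik g a n < loglik f a n}.
Proof.
move=> k01 hf C'0; have k00 : (0 < k0)%N by exact: ltnW.
have C0 : 0 < C by exact: (linear_bound_gt0 f_gt0 f_linear).
have [f1 h1 fk0 hk0] : [/\ 0 < f 1%N, 0 < h 1%N, 0 < f k0 & 0 < h k0].
  by split; rewrite ?f_gt0 ?h_gt0.
have [cL cL0 leaves] := ae_leaves_linear f_gt0 f_nondecreasing A_pa.
have [cG cG0 degs] := ae_deg_ge_linear f_gt0 A_pa f_linear (ltn0Sn k0).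
(* The ratio of the amplitudes at [k0] and 1; it differs from 1 by the hypothesis on [h], which
   gives [c0 > 0]. *)
pose mu := Num.sqrt ((h k0 / f k0) / (h 1%N / f 1%N)).
pose c0 := (mu - 1) ^+ 2 / (1 + mu ^+ 2).
have c00 : 0 < c0.
  rewrite divr_gt0//; last by rewrite ltr_pwDl// sqr_ge0.
  rewrite lt_def sqr_ge0 andbT sqrf_eq0 subr_eq0.
  apply: contra hf => /eqP mu1.
  have : mu ^+ 2 = 1 by rewrite mu1 expr1n.
  rewrite sqr_sqrtr; last by rewrite ltW// !divr_gt0.
  by move/divr1_eq => ->.
(* [c1] bounds the probability of choosing a leaf at large times, [c2] the time average of that of
   choosing degree [k0]. *)
pose c1 := f 1%N / (2 * C) * cL.
have c10 : 0 < c1 by rewrite mulr_gt0// divr_gt0// mulr_gt0.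
pose c2 := cG / 2.
have c20 : 0 < c2 by rewrite divr_gt0.
pose eta := c0 * c1 * c2.
have eta0 : 0 < eta by rewrite mulr_gt0// mulr_gt0.
(* [r] and [tau] are tuned so that [r ^+ 2 - 1] and the tail term are each at most [eta / 4],
   against an average gain of at least [eta]. *)
pose r := 1 + Num.min 1 (eta / 12).
have [r1 r2 r2eta] : [/\ 1 < r, r <= 2 & r ^+ 2 <= 1 + eta / 4].
  have x0 : 0 < Num.min 1 (eta / 12) by rewrite lt_min ltr01 divr_gt0.
  have x1 : Num.min 1 (eta / 12) <= 1 by rewrite ge_min lexx.
  have xe : Num.min 1 (eta / 12) <= eta / 12 by rewrite ge_min lexx orbT.
  rewrite /r; move: x0 x1 xe; set x := Num.min _ _ => x0 x1 xe.
  by split; nra.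
pose tau := h 1%N * eta / (8 * C').
have tau0 : 0 < tau by apply: divr_gt0; apply: mulr_gt0.
have [K0 tail] := f_tail tau0.
pose K := maxn K0 k0.
have k0K : (k0 <= K)%N by rewrite leq_maxr.
have K_gt0 : (0 < K)%N by exact: leq_trans k0K.
have r_ge1 : 1 <= r by exact: ltW.
exists r, K; split=> //.
pose Phi := amplitude f h C' r K.
have Phi_gt0 k : (0 < k)%N -> 0 < Phi k by move=> ?; exact: amplitude_gt0.
have Phi_mu : Phi k0 = mu * Phi 1%N.
  rewrite /Phi /amplitude /envelope k0K K_gt0 /mu -sqrtrM; last by rewrite ltW// !divr_gt0.
  by congr Num.sqrt; field; rewrite !gt_eqF.
pose s := scale f h r K.
pose x a t := s a t * cond_mean f Phi a t.
(* Dividing by [expR (x a t - 1)], which is at least the conditional mean [x a t], keeps the weight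
   positive with mean at most 1. *)
pose om t a k := s a t * expR (1 - x a t) * Phi k.
have om_gt0 t a k : (0 < t)%N -> valid_history a -> (0 < k)%N -> 0 < om t a k.
  by move=> t0 _ k_gt0; rewrite !mulr_gt0 ?expR_gt0 ?Phi_gt0// scale_gt0.
have om_pred t a b k : (forall u, (0 < u < t)%N -> a u = b u) -> om t a k = om t b k.
  move=> ab; rewrite /om /x /s.
  by rewrite (eq_scale_history _ _ _ _ ab) (eq_cond_mean_history _ _ ab).
have om_le t a : (0 < t)%N -> valid_history a ->
    deg_sum (fun k => f k * om t a k) a t <= deg_sum f a t.
  move=> t0 _; rewrite cond_meanE// ler_piMl//.
    by rewrite ltW// deg_sum_gt0.
  rewrite cond_meanZ mulrAC -/(x a t) -(opprB (x a t)) expRN ler_pdivrMr ?expR_gt0//.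
  by rewrite mul1r -[leLHS](subrKC 1) expR_ge1Dx.
(* The average of [x - 1] is at most [- eta / 4] up to [eps]; the two errors [eps] total at most
   [eta / 10]. *)
pose eps := Num.min (eta / 20) c2.
have eps0 : 0 < eps by rewrite lt_min c20 divr_gt0.
have [eps_eta eps_c2] : eps <= eta / 20 /\ eps <= c2.
  by split; rewrite ge_min lexx ?orbT.
have q_le1 k : `|(k == k0)%:R : R| <= 1 by rewrite normr_nat lern1 leq_b1.
have := ae_sum_ln_weight f_gt0 A_pa eps0 om_gt0 om_pred om_le.
have := ae_strong_law f_gt0 A_pa eps0 q_le1.
apply: filterS3 (filterI leaves (filterI degs tail)) => w /= [Hl [Hd Ht]] Hq Hom.
set a := fun t => A t w in Hl Hd Ht Hq Hom *.
have va : valid_history a by exact: pa_valid A_pa w.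
pose q t := cond_mean f (fun k => (k == k0)%:R) a t.
have drift : \forall t \near \oo, x a t - 1 <= 4^-1 * eta - 2^-1 * c0 * c1 * q t.
  near=> t; have t0 : (0 < t)%N by near: t; exact: nbhs_infty_gt.
  have t0' : 0 < t%:R :> R by rewrite ltr0n.
  have c1q : c1 <= cond_mean f (fun k => (k == 1%N)%:R) a t.
    rewrite -(ler_pM2r t0') (le_trans _ (cond_mean_eq_ge f_gt0 f_linear _ t0 va))//.
    rewrite /c1 -[leLHS]mulrA ler_pM2l ?divr_gt0 ?mulr_gt0//; near: t; exact: Hl.
  have tail_t : deg_sum (fun k => k%:R * (K < k)%:R) a t <= tau * t%:R.
    apply: (@le_trans _ _ (deg_sum (fun k => k%:R * (K0 < k)%:R) a t)); last first.
      by near: t.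
    apply: ler_deg_sum => k _; rewrite ler_wpM2l// ler_nat.
    have [Kk|//] := ltnP K k.
    by rewrite (leq_ltn_trans (leq_maxl K0 k0) Kk).
  have := cond_mean_amplitude_le f_gt0 h_gt0 h_nondecreasing C'0 r_ge1 K_gt0 t0 k01
    (ltW c10) Phi_mu c1q tail_t.
  rewrite -/c0 -/(q t) -/Phi -/s -/(x a t).
  have : r * C' * tau / h 1%N <= eta / 4.
    have -> : r * C' * tau / h 1%N = r * (eta / 8).
      by rewrite /tau; field; rewrite !gt_eqF.
    nra.
  lra.
have q_sum : \forall n \near \oo, c2 * n%:R <= \sum_(1 <= t < n) q t.
  apply: filterS2 Hd Hq => n; rewrite deg_sum_gtE// => Hd /ler_normlP[_ Hq].
  have : eps * n%:R <= c2 * n%:R by rewrite ler_wpM2r.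
  move: Hd Hq; rewrite -/q /c2; lra.
near=> n.
move=> g g0 g_le gh gC.
have n0 : (0 < n)%N by near: n; exact: nbhs_infty_gt.
have n0' : 0 < n%:R :> R by rewrite ltr0n.
have Hn : \sum_(1 <= t < n) (x a t - 1) <=
    \sum_(1 <= t < n) (4^-1 * eta - 2^-1 * c0 * c1 * q t) + eps * n%:R.
  by near: n; exact: sum_near_le.
have Hqn : c2 * n%:R <= \sum_(1 <= t < n) q t by near: n.
have Homn : \sum_(1 <= t < n) ln (om t a (chosen_degree a t)) <= eps * n%:R by near: n.
rewrite !loglikE// ltr_pM2l ?invr_gt0// -subr_lt0 -sumrB.
apply: (@le_lt_trans _ _ (2 * \sum_(1 <= t < n) (ln (om t a (chosen_degree a t)) + (x a t - 1)))).
  rewrite mulr_sumr; apply: ler_sum_nat => t /andP[t0 _].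
  have D0 : (0 < chosen_degree a t)%N by exact: degree_gt0.
  have := ln_likelihood_ratio_le f_gt0 h_gt0 C'0 r_ge1 K_gt0 a t0 D0 g0 g_le gh gC.
  move=> /le_trans; apply; rewrite ler_pM2l// -/Phi -/s.
  have -> : om t a (chosen_degree a t) = s a t * Phi (chosen_degree a t) * expR (1 - x a t).
    by rewrite /om mulrAC.
  have sPhi0 : 0 < s a t * Phi (chosen_degree a t) by rewrite mulr_gt0 ?Phi_gt0// scale_gt0.
  by rewrite [ln (_ * expR _)]lnM ?posrE ?expR_gt0// expRK -addrA subrKA subrr addr0.
rewrite big_split/= -[ltRHS](mulr0 2) ltr_pM2l//.
have sumE : \sum_(1 <= t < n) (4^-1 * eta - 2^-1 * c0 * c1 * q t) =
    (n - 1)%:R * (4^-1 * eta) - 2^-1 * c0 * c1 * \sum_(1 <= t < n) q t.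
  by rewrite sumrB sumr_const_nat -mulr_sumr mulr_natl.
move: Hn; rewrite sumE.
have : c0 * c1 * (c2 * n%:R) <= c0 * c1 * \sum_(1 <= t < n) q t.
  by rewrite ler_wpM2l// mulr_ge0// ltW.
have : eps * n%:R <= eta / 20 * n%:R by rewrite ler_wpM2r.
have : 0 < eta * n%:R by rewrite mulr_gt0.
have -> : c0 * c1 * (c2 * n%:R) = eta * n%:R by rewrite /eta; ring.
have : (n - 1)%:R * (4^-1 * eta) <= n%:R * (4^-1 * eta).
  by rewrite ler_wpM2r ?ler_nat ?leq_subr// mulr_ge0// ltW.
lra.
Unshelve. all: by end_near. Qed.

End separation.

(** * From local to compact avoidance *)

Section compact_avoidance.
Context {d : measure_display} {T : measurableType d} {R : realType}.
Context (P : probability T R) {X : topologicalType} (x_ : nat -> T -> X).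

(** One filter on pairs (outcome, time) encodes almost surely and eventually together, so that the
    near-covering form of compactness applies to it. *)
Let eventually_ae : set_system (T * nat) :=
  [set S | {ae P, forall w, \forall n \near \oo, S (w, n)}].

Let eventually_ae_filter : Filter eventually_ae.
Proof.
split.
- by apply: aeW => w; exact: filterT.
- move=> S1 S2; rewrite /eventually_ae/=; apply: filterS2 => w; apply: filterS2 => n; exact: conj.
- move=> S1 S2 S12; rewrite /eventually_ae/=; apply: filterS => w; apply: filterS => n; exact: S12.
Qed.

Lemma compact_ae_avoid (K : set X) : compact K ->
  (forall x, K x -> exists2 U, nbhs x U &
     {ae P, forall w, \forall n \near \oo, ~ U (x_ n w)}) ->
  {ae P, forall w, \forall n \near \oo, ~ K (x_ n w)}.
Proof.
move=> /compact_near_coveringP cK KU.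
have H : eventually_ae (fun wn => K `<=` (fun x => x_ wn.2 wn.1 <> x)).
  have := cK (T * nat)%type eventually_ae (fun wn x => x_ wn.2 wn.1 <> x) eventually_ae_filter.
  apply => x /KU[U Ux avoid].
  exists (U, [set wn | ~ U (x_ wn.2 wn.1)]); first by split.
  by move=> [y [w n]] /= [Uy nU] xy; apply: nU; rewrite xy.
move: H; rewrite /eventually_ae/=; apply: filterS => w.
by apply: filterS => n /= Kx Kn; exact: Kx Kn _.
Qed.

End compact_avoidance.

(** * Continuity and growth within the family *)

Lemma C2_within_near (R : realType) (d : nat) (D : set 'rV[R]_d) (g : 'rV[R]_d -> R)
    (x : 'rV[R]_d) (V : set R) :
  C2_within D g -> D x -> nbhs (g x) V -> \forall y \near x, D y -> V (g y).
Proof.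
move=> [U [g' [_ DU C2 gg']]] Dx Vgx.
have [cg' _ _] := C2 x (DU x Dx).
have : nbhs (g' x) V by rewrite -gg' ?inE.
move=> /cg' Vg'; have {}Vg' : \forall y \near x, V (g' y) by exact: Vg'.
apply: filterS Vg' => y Vy Dy.
by rewrite gg' ?inE.
Qed.

(** The term [f 1] absorbs [alpha], which [C] does not control. *)
Lemma sublinear_linear (R : realType) (f : nat -> R) (C : R) : 0 < C -> 0 < f 1 ->
  (exists2 beta : R, beta < 1 & forall k, (0 < k)%N -> f k <= C * k%:R `^ beta) \/
  (exists2 alpha : R, -1 < alpha & forall k, (0 < k)%N -> f k = k%:R + alpha) ->
  forall k, (0 < k)%N -> f k <= (C + 1 + f 1) * k%:R.
Proof.
move=> C0 f10 [[beta beta1 fC]|[alpha alpha1 fE]] k k0; have k1 : 1 <= k%:R :> R by rewrite ler1n.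
- have : C * k%:R `^ beta <= C * k%:R.
    by rewrite ler_pM2l// -[leRHS]powRr1 ?(le_trans ler01)// ler_powR// ltW.
  have := fC k k0; have : 0 <= (1 + f 1%N) * k%:R by rewrite mulr_ge0// addr_ge0// ltW.
  lra.
- rewrite (fE k)// (fE 1%N)//.
  have : 0 <= C * k%:R by rewrite mulr_ge0// ltW.
  nra.
Qed.

(** * Consistency of the maximum likelihood estimator *)

Theorem theorem4p1 (R : realType) (d : nat) (Theta : set 'rV[R]_d)
    (f : 'rV[R]_d -> nat -> R) (C : R) (theta0 : 'rV[R]_d)
    (dT : measure_display) (T : measurableType dT) (P : probability T R)
    (A : nat -> {RV P >-> nat}) (theta_hat : nat -> T -> 'rV[R]_d)
    (Theta_compact : compact Theta)
    (f_gt0 : forall theta, Theta theta ->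
       forall k, (0 < k)%N -> 0 < f theta k)
    (f_nondecreasing : forall theta, Theta theta ->
       forall j k, (0 < j)%N -> (j <= k)%N -> f theta j <= f theta k)
    (f_C2 : forall k, (0 < k)%N -> C2_within Theta (fun theta => f theta k))
    (C_gt0 : 0 < C)
    (f_growth : forall theta, Theta theta ->
       (exists2 beta : R, beta < 1 &
          forall k, (0 < k)%N -> f theta k <= C * k%:R `^ beta) \/
       (exists2 alpha : R, -1 < alpha &
          forall k, (0 < k)%N -> f theta k = k%:R + alpha))
    (theta0_in : Theta theta0)
    (theta0_identifiable : forall theta, Theta theta ->
       ((exists c : R, forall k, (0 < k)%N -> f theta k = c * f theta0 k) <->
        theta = theta0))
    (A_pa_tree : is_pa_tree (f theta0) A)
    (theta_hat_MLE : forall n w, (0 < n)%N ->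
       Theta (theta_hat n w) /\
       forall theta, Theta theta ->
         loglik (f theta) (fun t => A t w) n <=
         loglik (f (theta_hat n w)) (fun t => A t w) n) :
  {ae P, forall w, theta_hat ^~ w @ \oo --> theta0}.
Proof.
have f0_gt0 := f_gt0 _ theta0_in; have f0_le := f_nondecreasing _ theta0_in.
have f0_linear := sublinear_linear C_gt0 (f0_gt0 1%N isT) (f_growth _ theta0_in).
have f0_tail (tau : R) : 0 < tau ->
  exists K, {ae P, forall w, let a := fun t => A t w in
    \forall n \near \oo, deg_sum (fun k => k%:R * (K < k)%:R) a n <= tau * n%:R}.
  have [[beta beta1 fC]|[alpha alpha1 fE]] := f_growth _ theta0_in.
  - exact: (ae_tail_sublinear f0_gt0 A_pa_tree f0_le beta1 fC).
  - exact: (ae_tail_affine f0_gt0 A_pa_tree alpha1 fE).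
have avoid theta1 : Theta theta1 -> theta1 <> theta0 -> exists2 U, nbhs theta1 U &
    {ae P, forall w, \forall n \near \oo, ~ U (theta_hat n w)}.
  move=> Th1 Th10.
  have h_gt0 := f_gt0 _ Th1; have h_le := f_nondecreasing _ Th1.
  have [k0 k01 k0P] : exists2 k0, (1 < k0)%N &
      f theta1 k0 / f theta0 k0 != f theta1 1%N / f theta0 1%N.
    (* If every ratio equalled the one at degree 1, [f theta1] would be a multiple of [f theta0]. *)
    apply: contrapT => H; apply: Th10; apply/(theta0_identifiable _ Th1).
    exists (f theta1 1%N / f theta0 1%N) => k kpos.
    have [->|k1] := eqVneq k 1%N; first by rewrite divfK// gt_eqF// f0_gt0.
    have k1' : (1 < k)%N by rewrite ltn_neqAle eq_sym k1.
    apply/eqP; apply: contrapT => /negP kP; apply: H; exists k => //.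
    by apply: contra kP => /eqP <-; rewrite divfK// gt_eqF// f0_gt0.
  (* A linear growth constant valid for all parameters near [theta1], where the value at degree 1
     exceeds that of [theta1] by at most 1. *)
  pose C' := C + 1 + (f theta1 1%N + 1).
  have C'0 : 0 < C' by have := h_gt0 1%N isT; rewrite /C'; lra.
  have [r [K [r1 lt_ae]]] := ae_loglik_lt f0_gt0 f0_le A_pa_tree f0_linear f0_tail
    h_gt0 h_le k01 k0P C'0.
  have near_ratio k : (0 < k)%N -> \forall theta \near theta1, Theta theta ->
      f theta k <= r * f theta1 k /\ f theta1 k <= r * f theta k.
    move=> kpos; have hk := h_gt0 k kpos.
    suff H : nbhs (f theta1 k) [set y | y <= r * f theta1 k /\ f theta1 k <= r * y].
      exact: (C2_within_near (f_C2 k kpos) Th1 H).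
    have r0 : 0 < r by lra.
    near=> y; split.
      by near: y; apply: lt_le_nbhsl; rewrite ltr_pMl.
    rewrite -ler_pdivrMl//; near: y; apply: lt_le_nbhsr.
    by rewrite ltr_pdivrMl// ltr_pMl.
  have near_ratios : \forall theta \near theta1, forall k, (k <= K)%N -> (0 < k)%N ->
      Theta theta -> f theta k <= r * f theta1 k /\ f theta1 k <= r * f theta k.
    elim: (K) => [|K' IH]; first by near=> theta; case.
    near=> theta => k; rewrite leq_eqVlt => /predU1P[-> _|].
      by near: theta; exact: near_ratio.
    by rewrite ltnS; move: k; near: theta; exact: IH.
  have near_1 : \forall theta \near theta1, Theta theta ->
      f theta 1%N <= f theta1 1%N + 1.
    have H : nbhs (f theta1 1%N) [set y | y <= f theta1 1%N + 1].
      by apply: lt_le_nbhsl; rewrite ltrDl.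
    exact: (C2_within_near (f_C2 1%N isT) Th1 H).
  eexists; first exact: filterI near_ratios near_1.
  (* Were the estimator in this neighbourhood, it would have a smaller likelihood than [theta0]. *)
  apply: filterS lt_ae => w /=; apply: filterS2 (nbhs_infty_gt 0) => n n0 Hn [ratios one].
  have [Th_n MLE] := theta_hat_MLE n w n0.
  have g_gt0 := f_gt0 _ Th_n.
  have := MLE _ theta0_in; apply/negP; rewrite -ltNge.
  apply: Hn => //.
  - exact: f_nondecreasing.
  - by move=> k /andP[k0' kK]; exact: ratios.
  - move=> k k0'; apply: (le_trans (sublinear_linear C_gt0 (g_gt0 1%N isT) (f_growth _ Th_n) k0')).
    by rewrite ler_wpM2r// lerD2l one.
(* Removing the interior of a ball leaves a compact set; countably many radii share one null set. *)
have far m : {ae P, forall w, \forall n \near \oo,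
    ~ (Theta `&` ~` (ball theta0 m.+1%:R^-1)°) (theta_hat n w)}.
  apply: compact_ae_avoid.
    by apply: compact_closedI => //; apply: open_closedC; exact: open_interior.
  move=> theta1 [Th1 nball]; apply: avoid => // E; apply: nball; rewrite E.
  by rewrite /interior; apply: nbhsx_ballx; rewrite invr_gt0.
apply: filterS (ae_foralln far) => w Hw.
apply/cvg_ballP => e e0.
have [m me] : exists m : nat, m.+1%:R^-1 < e.
  have [N _ HN] := near_infty_natSinv_lt (PosNum e0).
  by exists N; exact: (HN N (leqnn N)).
apply: filterS2 (nbhs_infty_gt 0) (Hw m) => n n0 nfar.
have [Th_n _] := theta_hat_MLE n w n0.
apply: (le_ball (ltW me)); apply: interior_subset.
by apply: contrapT => H; apply: nfar.
Unshelve. all: by end_near. Qed.
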